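(* Let $F=F(\varrho,u,x^1,\dots,x^{n-2})$ be a smooth function on $\mathbb R^n$. Then the metric $$\widetilde g_F=2\,d(t\varrho)\,dt+t^2\Big(2\,du\,(dv+F\,du)+\delta_{AB}\,dx^A dx^B\Big)$$ on $\widetilde M=\mathbb R^{n+1}\times\mathbb R_{>0}$ satisfies the following properties: (i) The distribution $\widetilde{\mathcal V}=\mathrm{span}(\partial_v,\partial_\varrho)$ is parallel, i.e., invariant under parallel transport. (ii) Let $\mathcal V=\mathbb R\cdot\partial_v$ be the distribution of null lines spanned by $\partial_v$ and $\mathcal V^\perp=\mathrm{span}(\partial_v,\partial_\varrho,\partial_1,\dots,\partial_{n-2},\partial_t)$ the distribution of vectors in $T\widetilde M$ orthogonal to $\partial_v$. Then the curvature $\widetilde R$ of $\widetilde g_F$ satisfies $\widetilde R(U,V)Y=0$ for all $U,V\in\mathcal V^\perp$ and $Y\in T\widetilde M$. (iii) The holonomy algebra $\mathfrak{hol}(\widetilde g_F)$ is contained in $$\big(\mathfrak{sl}_2\mathbb R\ltimes(\mathbb R^2\otimes\mathbb R^{n-2})\big)\oplus\mathbb R=\left\{\begin{pmatrix}X&Z&aJ\\ 0&0&-Z^\top\\ 0&0&-X^\top\end{pmatrix}\ \Big|\ X\in\mathfrak{sl}_2\mathbb R,\ Z\in\mathbb R^2\otimes\mathbb R^{n-2},\ a\in\mathbb R\right\},$$ where $J=\begin{pmatrix}0&1\\ -1&0\end{pmatrix}$.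
   Context: Coordinates on $\widetilde M$ are $t>0$ and $(\varrho,u,v,x^1,\dots,x^{n-2})\in\mathbb R^{n+1}$; $A,B=1,\dots,n-2$ with summation convention; $\partial_A=\partial/\partial x^A$; products of one-forms are symmetric products. A distribution is parallel if it is invariant under the Levi-Civita connection $\widetilde\nabla$ of $\widetilde g_F$. The holonomy algebra at a point $p$ is a subalgebra of $\mathfrak{so}(T_p\widetilde M,\widetilde g_F)\simeq\mathfrak{so}(2,n)$ and is considered up to conjugation; the matrices in (iii) are with respect to a basis of $T_p\widetilde M$ in which the metric has block form $\begin{pmatrix} 0 & 0 & I_2 \\ 0 & I_{n-2} & 0 \\ I_2 & 0 & 0 \end{pmatrix}$ and whose first two vectors span $\widetilde{\mathcal V}|_p$. The left hand side in (iii) is notation for the set (Lie algebra) of matrices on the right hand side. *)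

(* Defs.v *)
From HB Require Import structures.
From mathcomp Require Import all_boot all_order all_algebra.
From mathcomp Require Import all_classical all_reals all_analysis.

Set Implicit Arguments.
Unset Strict Implicit.
Unset Printing Implicit Defensive.

Import Order.TTheory GRing.Theory Num.Theory.
Import numFieldNormedType.Exports.

Local Open Scope classical_set_scope.
Local Open Scope ring_scope.

(* Points of R^N and tangent vectors at them are column vectors; endomorphisms
   of a tangent space are matrices acting on the left; covectors are rows. *)

Section Calculus.
Context {R : realType} {N : nat}.
Implicit Types (U : set 'cV[R]_N) (f : 'cV[R]_N -> R) (p : 'cV[R]_N).

Definition evec (i : 'I_N) : 'cV[R]_N := delta_mx i 0.

Definition partial (i : 'I_N) f p : R := 'D_(evec i) f p.

Fixpoint Ck_on U (k : nat) f : Prop :=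
  (forall p, U p -> {for p, continuous f}) /\
  match k with
  | 0%N => True
  | k'.+1 => forall i, (forall p, U p -> derivable f p (evec i)) /\
                       Ck_on U k' (partial i f)
  end.

Definition smooth_on U f : Prop := forall k, Ck_on U k f.

(* Vector fields are total functions; only their values on U matter. *)
Definition smooth_vfield_on U (X : 'cV[R]_N -> 'cV[R]_N) : Prop :=
  forall k, smooth_on U (fun p => X p k 0).

Definition coord (i : 'I_N) p : R := p i 0.

Definition differential f p : 'rV[R]_N := \row_i partial i f p.

(* Normalised so that symprod a a is the tensor square of a. *)
Definition symprod (a b : 'rV[R]_N) : 'M[R]_N :=
  2%:R^-1 *: (a^T *m b + b^T *m a).

End Calculus.

Definition smooth_curve {R : realType} {m n : nat} (c : R -> 'M[R]_(m, n)) : Prop :=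
  forall i j k s, derivable (derive1n k (fun r => c r i j)) s 1.

Definition curve_deriv {R : realType} {m n : nat} (c : R -> 'M[R]_(m, n)) (s : R) :
    'M[R]_(m, n) :=
  \matrix_(i, j) derive1 (fun r => c r i j) s.

(* Pseudo-Riemannian geometry of a metric g on an open subset U of R^N, where
   g p is the Gram matrix of the coordinate fields at p. *)
Section PseudoRiemannian.
Context {R : realType} {N : nat}.
Variables (g : 'cV[R]_N -> 'M[R]_N) (U : set 'cV[R]_N).
Implicit Types (X Y Z : 'cV[R]_N -> 'cV[R]_N) (D : 'cV[R]_N -> set 'cV[R]_N).

Definition inner (p v w : 'cV[R]_N) : R := (v^T *m g p *m w) 0 0.

(* Christoffel symbol with upper index k and lower indices i, j, of the
   Levi-Civita connection. *)
Definition christoffel (k i j : 'I_N) (p : 'cV[R]_N) : R :=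
  2%:R^-1 * \sum_l invmx (g p) k l *
    (partial i (fun q => g q j l) p + partial j (fun q => g q i l) p
     - partial l (fun q => g q i j) p).

(* covderiv X Y is the covariant derivative of Y in the direction X. *)
Definition covderiv X Y : 'cV[R]_N -> 'cV[R]_N := fun p =>
  \col_k \sum_i X p i 0 *
    (partial i (fun q => Y q k 0) p + \sum_j christoffel k i j p * Y p j 0).

Definition lie_bracket X Y : 'cV[R]_N -> 'cV[R]_N := fun p =>
  \col_k \sum_i (X p i 0 * partial i (fun q => Y q k 0) p
                 - Y p i 0 * partial i (fun q => X q k 0) p).

Definition curvature X Y Z : 'cV[R]_N -> 'cV[R]_N := fun p =>
  covderiv X (covderiv Y Z) p - covderiv Y (covderiv X Z) p
  - covderiv (lie_bracket X Y) Z p.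

Definition section_of D X : Prop := forall p, U p -> D p (X p).

Definition connection_invariant D : Prop :=
  forall X Y, smooth_vfield_on U X -> smooth_vfield_on U Y ->
  section_of D Y -> section_of D (covderiv X Y).

Definition orth D (p : 'cV[R]_N) : set 'cV[R]_N :=
  [set w | forall v, D p v -> inner p v w = 0].

(* The vector field V is parallel along the restriction of c to [0, 1]. *)
Definition parallel_along (c V : R -> 'cV[R]_N) : Prop :=
  forall k, {within `[0, 1], continuous (fun s => V s k 0)} /\
    forall s : R, 0 < s < 1 ->
      is_derive s 1 (fun r => V r k 0)
        (- \sum_i \sum_j
             christoffel k i j (c s) * curve_deriv c s i 0 * V s j 0).

(* par_transport p q P: the matrix P is the parallel transport from T_p to T_q
   along some piecewise smooth curve in U, i.e. along a finite concatenation of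
   smooth arcs. A smooth arc is the restriction to [0, 1] of a smooth map
   defined on the real line. *)
Inductive par_transport : 'cV[R]_N -> 'cV[R]_N -> 'M[R]_N -> Prop :=
| par_transport_arc (c : R -> 'cV[R]_N) (P : 'M[R]_N) :
    smooth_curve c -> (forall s, 0 <= s <= 1 -> U (c s)) ->
    (forall w : 'cV[R]_N, exists V : R -> 'cV[R]_N,
        [/\ parallel_along c V, V 0 = w & V 1 = P *m w]) ->
    par_transport (c 0) (c 1) P
| par_transport_concat (p q r : 'cV[R]_N) (P Q : 'M[R]_N) :
    par_transport p q P -> par_transport q r Q -> par_transport p r (Q *m P).

Definition transport_invariant D : Prop :=
  forall p q P, par_transport p q P -> forall w, D p w -> D q (P *m w).

Definition holonomy_group (p : 'cV[R]_N) : set 'M[R]_N :=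
  [set P | par_transport p p P].

(* The Lie algebra of the holonomy group: the velocities at the identity of the
   smooth curves of matrices that stay in the group. *)
Definition holonomy_algebra (p : 'cV[R]_N) : set 'M[R]_N :=
  [set A | exists c : R -> 'M[R]_N,
    [/\ smooth_curve c, c 0 = 1%:M, forall s, holonomy_group p (c s)
      & curve_deriv c 0 = A]].

End PseudoRiemannian.

(* With n = 2 + m, the ambient space has dimension n + 2 = 2 + (m + 2). Its
   coordinates are ordered as (v, rho, x^1, ..., x^m, u, t). *)
Notation adim m := (2 + (m + 2))%N.

Section AmbientMetric.
Context {R : realType} {m : nat}.

Definition i_v : 'I_(adim m) := lshift (m + 2) (0 : 'I_2).
Definition i_rho : 'I_(adim m) := lshift (m + 2) (1 : 'I_2).
Definition i_x (A : 'I_m) : 'I_(adim m) := rshift 2 (lshift 2 A).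
Definition i_u : 'I_(adim m) := rshift 2 (rshift m (0 : 'I_2)).
Definition i_t : 'I_(adim m) := rshift 2 (rshift m (1 : 'I_2)).

Definition ambient_space : set 'cV[R]_(adim m) := [set p | 0 < coord i_t p].

(* The arguments (rho, u, x^1, ..., x^m) of F at the point p. *)
Definition F_args (p : 'cV[R]_(adim m)) : 'cV[R]_(2 + m) :=
  col_mx (\col_(k < 2) if k == 0 then coord i_rho p else coord i_u p)
         (\col_(A < m) coord (i_x A) p).

Definition ambient_metric (F : 'cV[R]_(2 + m) -> R) (p : 'cV[R]_(adim m)) :
    'M[R]_(adim m) :=
  let d i := differential (coord i) p in
  2%:R *: symprod (differential (fun q => coord i_t q * coord i_rho q) p) (d i_t)
  + coord i_t p ^+ 2 *:
      (2%:R *: symprod (d i_u) (d i_v + F (F_args p) *: d i_u)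
       + \sum_(A < m) symprod (d (i_x A)) (d (i_x A))).

Definition dist_Vtilde (_ : 'cV[R]_(adim m)) : set 'cV[R]_(adim m) :=
  [set w | exists a b : R, w = a *: evec i_v + b *: evec i_rho].

Definition dist_V (_ : 'cV[R]_(adim m)) : set 'cV[R]_(adim m) :=
  [set w | exists a : R, w = a *: evec i_v].

(* span (d_v, d_rho, d_1, ..., d_m, d_t) *)
Definition dist_hyperplane (_ : 'cV[R]_(adim m)) : set 'cV[R]_(adim m) :=
  [set w | exists (a b c : R) (y : 'I_m -> R),
    w = a *: evec i_v + b *: evec i_rho + \sum_(A < m) y A *: evec (i_x A)
        + c *: evec i_t].

Definition block_metric : 'M[R]_(adim m) :=
  block_mx 0 (row_mx 0 1%:M)
           (col_mx 0 1%:M) (block_mx 1%:M 0 0 0).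

Definition Jmx : 'M[R]_2 := \matrix_(i, j) ((i < j)%N%:R - (j < i)%N%:R).

Definition hol_block_algebra : set 'M[R]_(adim m) :=
  [set M | exists (X : 'M[R]_2) (Z : 'M[R]_(2, m)) (a : R),
    \tr X = 0 /\
    M = block_mx X (row_mx Z (a *: Jmx))
                 0 (block_mx 0 (- Z^T)
                             0 (- X^T))].

(* The columns of B form a basis of T_p in which the metric g p has the block
   form above and whose first two vectors span the fibre of dist_Vtilde. *)
Definition adapted_basis (g : 'cV[R]_(adim m) -> 'M[R]_(adim m))
    (p : 'cV[R]_(adim m)) (B : 'M[R]_(adim m)) : Prop :=
  [/\ B \in unitmx, B^T *m g p *m B = block_metric
    & forall w, dist_Vtilde p w <-> exists c : 'cV[R]_2, w = lsubmx B *m c].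

End AmbientMetric.

(* Main.v *)
(* Write G for F as a function on the ambient space and Gamma(X, Z) for the
   Christoffel form. The rows of Gamma(X, Z) show that a parallel field V along a
   curve satisfies (t V_u)' = - u' V_t and V_t' = t G_rho u' V_u; once
   V_u = V_t = 0, also (t V_A)' = 0. The first system is traceless, so the
   Wronskian of two parallel fields is constant. Since parallel transport preserves
   the metric, parallel frames span at every time, and the Wronskian against such a
   frame forces V_u = V_t = 0 to persist: this gives invariance of Vtilde without an
   ODE uniqueness theorem. For loops, it also gives that transport is unimodular
   on Vtilde and trivial on Vtilde^perp / Vtilde; differentiating at the identity
   yields the block form.
   For the curvature, if X_u = 0 then every coefficient of Gamma(X, .) is a
   directional derivative along X of a coordinate or of G, so R(X, Y) Z is an
   algebraic expression in which everything cancels by [D_X, D_Y] = D_[X, Y]. *)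
Require Import Defs.
From mathcomp Require Import all_boot all_order all_algebra.
From mathcomp Require Import all_classical all_reals all_analysis.
From mathcomp Require Import ring lra.

Set Implicit Arguments.
Unset Strict Implicit.
Unset Printing Implicit Defensive.

Import Order.TTheory GRing.Theory Num.Theory.
Import numFieldNormedType.Exports.

Local Open Scope classical_set_scope.
Local Open Scope ring_scope.

(** * Calculus on R^N *)

(** The symbols [christoffel] contain [invmx (g p)], which is kept abstract. A closed form
    [christoffel_form] is checked against the Koszul formula with the upper index lowered, and
    invertibility of [g p] transfers the identity; invertibility itself comes from an explicit
    frame. Smoothness is given through iterated partial derivatives, so the symmetry of mixed
    partials and the chain rule along curves are both drawn from the one-variable mean value
    theorem. Since [holonomy_algebra] consists of velocities of curves of loop transports, it
    suffices to find identities that hold for every transport matrix and to differentiate them. The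
    Wronskian lives on the quotient of the tangent space by Vtilde^perp, with coordinates u and t,
    whereas (iii) asks for trace zero on Vtilde: the metric makes these two planes dual, which turns
    one trace into minus the other. The middle block vanishes because d_A / t is parallel modulo
    Vtilde and t returns to its initial value along a loop. *)

Section Calculus.
Context {R : realType} {N : nat}.
Implicit Types (U : set 'cV[R]_N) (f g : 'cV[R]_N -> R) (p v w : 'cV[R]_N).

Lemma is_derive_line f v p (s : R) :
  derivable f (s *: v + p) v ->
  is_derive s 1 (fun r => f (r *: v + p)) ('D_v f (s *: v + p)).
Proof.
have E : (fun h : R => h^-1 *: (f ((h *: 1 + s) *: v + p) - f (s *: v + p)))
       = (fun h : R => h^-1 *: (f (h *: v + (s *: v + p)) - f (s *: v + p))).
  by apply/funext => h; rewrite scalerDl addrA -[h *: 1]/(h * 1) mulr1.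
move=> df; apply: DeriveDef; first by rewrite /derivable /= E.
by rewrite /derive /= E.
Qed.

Lemma MVT_line f v p (h : R) : 0 <= h ->
  (forall s, 0 <= s <= h -> derivable f (s *: v + p) v) ->
  exists2 s, 0 <= s <= h & f (h *: v + p) - f p = h * 'D_v f (s *: v + p).
Proof.
move=> h0 df.
have [||s sh] := @MVT_segment R (fun r => f (r *: v + p))
    (fun r => 'D_v f (r *: v + p)) 0 h h0.
- move=> x; rewrite in_itv /= => /andP[x0 xh]; apply: is_derive_line.
  by apply: df; rewrite !ltW.
- apply: derivable_within_continuous => x; rewrite in_itv /= => xh.
  by case: (is_derive_line (df x xh)).
rewrite scale0r add0r subr0 => ->; exists s; last by rewrite mulrC.
by rewrite in_itv /= in sh.
Qed.

(** Two uses of the mean value theorem: in direction [v] for the increment of [f] over [h *: w],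
    then in direction [w] for ['D_v f]. The left side is symmetric in [v] and [w], the right side is
    not, and this is what makes mixed partials comparable. *)
Lemma rectangle_MVT f v w p (h : R) : 0 <= h ->
  (forall a b, 0 <= a <= h -> 0 <= b <= h ->
     derivable f (a *: v + (b *: w + p)) v) ->
  (forall a b, 0 <= a <= h -> 0 <= b <= h ->
     derivable (fun q => 'D_v f q) (a *: v + (b *: w + p)) w) ->
  exists a b, [/\ 0 <= a <= h, 0 <= b <= h &
    f (h *: v + (h *: w + p)) - f (h *: v + p) - f (h *: w + p) + f p
    = h ^+ 2 * 'D_w (fun q => 'D_v f q) (a *: v + (b *: w + p))].
Proof.
move=> h0 df ddf.
have h0h : 0 <= h <= h by rewrite h0 lexx.
have h00 : 0 <= (0 : R) <= h by rewrite h0 lexx.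
pose g q := f (q + h *: w) - f q.
have trE (u q : 'cV[R]_N) : derivable f (q + u) v ->
    derivable (fun x => f (x + u)) q v /\
    'D_v (fun x => f (x + u)) q = 'D_v f (q + u).
  rewrite /derivable /derive /=.
  have -> : (fun r : R => r^-1 *: (f (r *: v + q + u) - f (q + u)))
          = (fun r : R => r^-1 *: (f (r *: v + (q + u)) - f (q + u))).
    by apply/funext => r; rewrite addrA.
  by [].
have shE a : a *: v + p + h *: w = a *: v + (h *: w + p).
  by rewrite -addrA [p + _]addrC.
have dfp a : 0 <= a <= h -> derivable f (a *: v + p) v.
  by move=> ah; have := df a 0 ah h00; rewrite scale0r add0r.
have dg a : 0 <= a <= h -> derivable g (a *: v + p) v.
  move=> ah; apply: derivableB; last exact: dfp.
  by apply: (trE _ _ _).1; rewrite shE; exact: df.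
have [a ah ga] := MVT_line h0 dg.
have ga' : 'D_v g (a *: v + p)
    = 'D_v f (h *: w + (a *: v + p)) - 'D_v f (a *: v + p).
  have df1 : derivable f (a *: v + p + h *: w) v by rewrite shE; exact: df.
  have [d1 e1] := trE _ _ df1.
  by rewrite deriveB ?e1 //; [rewrite [_ + h *: w]addrC|exact: dfp].
have swp b : b *: w + (a *: v + p) = a *: v + (b *: w + p) by rewrite addrCA.
have ddf' b : 0 <= b <= h -> derivable (fun q => 'D_v f q) (b *: w + (a *: v + p)) w.
  by move=> bh; rewrite swp; exact: ddf.
have [b bh gb] := MVT_line h0 ddf'.
exists a, b; split; [exact: ah|exact: bh|].
have -> : f (h *: v + (h *: w + p)) - f (h *: v + p) - f (h *: w + p) + f p
    = g (h *: v + p) - g p.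
  by rewrite /g shE [p + _]addrC opprB [RHS]addrA [LHS]addrAC.
rewrite [LHS]ga ga' [X in _ * X]gb.
rewrite mulrA -expr2.
exact: (congr1 (fun q => h ^+ 2 * 'D_w (fun q => 'D_v f q) q) (swp b)).
Qed.

Lemma near_cV p (P : 'cV[R]_N -> Prop) : (\forall q \near p, P q) ->
  exists2 e : R, 0 < e & forall q, `|p - q| < e -> P q.
Proof. by move=> /nbhs_normP[e /= e0 eP]; exists e => // q; apply: eP. Qed.

Lemma cV_near p (P : 'cV[R]_N -> Prop) (e : R) : 0 < e ->
  (forall q, `|p - q| < e -> P q) -> \forall q \near p, P q.
Proof. by move=> e0 eP; apply/nbhs_normP; exists e => // q; apply: eP. Qed.

Lemma normr_coord_le p (i : 'I_N) : `|p i 0| <= `|p|.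
Proof.
rewrite [`|p|]/Num.Def.normr /= mx_normE.
rewrite (_ : `|p i 0| = (`|p i 0|%:nng)%:num) // num_le.
exact: (le_bigmax _ (fun ij : 'I_N * 'I_1 => `|p ij.1 ij.2|%:nng) (i, 0)).
Qed.

Lemma cV_norm_le p (r : R) : 0 <= r -> (forall i, `|p i 0| <= r) -> `|p| <= r.
Proof.
move=> r0 H; rewrite [`|p|]/Num.Def.normr /= mx_normE.
rewrite (_ : r = (NngNum r0)%:num) // num_le; apply: bigmax_le => //= -[k j] _.
by rewrite -num_le /= ord1; exact: H.
Qed.

Lemma norm_evec_le1 (i : 'I_N) : `|evec i : 'cV[R]_N| <= 1.
Proof.
apply: cV_norm_le => [|k]; first exact: ler01.
by rewrite mxE eqxx andbT; case: eqP; rewrite ?normr1 ?normr0.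
Qed.

(* Both mixed partials are limits of the same second difference quotient. *)
Lemma partialC U f p (i j : 'I_N) : open U -> U p -> Ck_on U 2 f ->
  partial i (partial j f) p = partial j (partial i f) p.
Proof.
move=> oU Up f2.
have d1 k q : U q -> derivable f q (evec k) by move=> Uq; apply: (f2.2 k).1.
have d2 k l q : U q -> derivable (partial k f) q (evec l).
  by move=> Uq; apply: ((f2.2 k).2.2 l).1.
have c2 k l : {for p, continuous (partial l (partial k f))}.
  by apply: ((f2.2 k).2.2 l).2.1.
apply/eqP; rewrite -subr_eq0 -normr_le0; apply/ler_addgt0Pr => /= e e0.
rewrite add0r.
have e20 : 0 < e / 2 by rewrite divr_gt0.
have : \forall q \near p, [/\ U q,
    `|partial i (partial j f) p - partial i (partial j f) q| < e / 2 &
    `|partial j (partial i f) p - partial j (partial i f) q| < e / 2].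
  have n1 : \forall q \near p, U q by apply: open_nbhs_nbhs.
  have /cvgrPdist_lt/(_ _ e20) n2 := c2 j i.
  have /cvgrPdist_lt/(_ _ e20) n3 := c2 i j.
  apply: filterS (filterI n1 (filterI n2 n3)) => q [u1 [u2 u3]].
  split; [exact: u1|exact: u2|exact: u3].
move=> /near_cV[d d0 Pd].
(* The points of the square with side [h] lie at sup distance at most 2h from [p], so any fraction
   of [d] below 1/2 keeps them in the ball. *)
pose h := d / 3.
have h0 : 0 < h by rewrite divr_gt0.
have nearq a b : 0 <= a <= h -> 0 <= b <= h ->
    `|p - (a *: evec i + (b *: evec j + p))| < d.
  move=> /andP[a0 ah] /andP[b0 bh].
  rewrite addrA opprD addrCA subrr addr0 normrN.
  apply: le_lt_trans (ler_normD _ _) _; rewrite !normrZ !ger0_norm //.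
  have := norm_evec_le1 i; have := norm_evec_le1 j => Hj Hi.
  have Ha : a * `|evec i| <= a by rewrite ler_piMr.
  have Hb : b * `|evec j| <= b by rewrite ler_piMr.
  have : h + h < d by rewrite /h; lra.
  lra.
have [a [b [ah bh Eij]]] := @rectangle_MVT f (evec i) (evec j) p h (ltW h0)
  (fun a b ah bh => d1 i _ (let: And3 u _ _ := Pd _ (nearq a b ah bh) in u))
  (fun a b ah bh => d2 i j _ (let: And3 u _ _ := Pd _ (nearq a b ah bh) in u)).
have nearq' a' b' : 0 <= a' <= h -> 0 <= b' <= h ->
    `|p - (a' *: evec j + (b' *: evec i + p))| < d.
  by move=> ? ?; rewrite addrCA; apply: nearq.
have [a' [b' [ah' bh' Eji]]] := @rectangle_MVT f (evec j) (evec i) p h (ltW h0)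
  (fun a b ah bh => d1 j _ (let: And3 u _ _ := Pd _ (nearq' a b ah bh) in u))
  (fun a b ah bh => d2 j i _ (let: And3 u _ _ := Pd _ (nearq' a b ah bh) in u)).
have [_ _ Q1] := Pd _ (nearq a b ah bh).
have [_ Q2 _] := Pd _ (nearq' a' b' ah' bh').
have E : partial j (partial i f) (a *: evec i + (b *: evec j + p)) =
         partial i (partial j f) (a' *: evec j + (b' *: evec i + p)).
  have h2 : h ^+ 2 != 0 by rewrite expf_neq0 // gt_eqF.
  apply: (mulfI h2); apply: etrans (esym Eij) _; apply: etrans _ Eji.
  rewrite [in RHS]addrCA; congr (_ + _); exact: addrAC.
rewrite E in Q1.
move: Q1 Q2; set x := partial i _ p; set y := partial j _ p; set z := partial i _ _.
move=> Q1 Q2; have -> : x - y = (x - z) - (y - z) by ring.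
apply: le_trans (ler_normB _ _) _.
by rewrite [leRHS]splitr; apply: lerD; apply: ltW; [exact: Q2|exact: Q1].
Qed.

End Calculus.

Section ScalarDerivatives.
Context {R : realType} {V : normedModType R}.
Implicit Types (f g : V -> R) (x v : V).

Lemma is_derive_add f g x v (a b : R) : is_derive x v f a -> is_derive x v g b ->
  is_derive x v (fun y => f y + g y) (a + b).
Proof. exact: is_deriveD. Qed.

Lemma is_derive_mul f g x v (a b : R) : is_derive x v f a -> is_derive x v g b ->
  is_derive x v (fun y => f y * g y) (a * g x + f x * b).
Proof.
move=> fa gb; have := is_deriveM fa gb; rewrite /GRing.scale /=.
by rewrite addrC [g x * a]mulrC.
Qed.

Lemma is_derive_opp f x v (a : R) : is_derive x v f a ->
  is_derive x v (fun y => - f y) (- a).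
Proof. exact: is_deriveN. Qed.

Lemma is_derive_const (c : R) x v : is_derive x v (fun _ : V => c) 0.
Proof. exact: is_derive_cst. Qed.

Lemma is_derive_inv f x v (a : R) : f x != 0 -> is_derive x v f a ->
  is_derive x v (fun y => (f y)^-1) (- (f x) ^- 2 * a).
Proof.
move=> fx0 [df <-]; apply: DeriveDef; first exact: derivableV.
exact: (deriveV fx0 df).
Qed.

Lemma is_derive_bigsum (I : finType) (f : I -> V -> R) x v (a : I -> R) :
  (forall i, is_derive x v (f i) (a i)) ->
  is_derive x v (fun y => \sum_i f i y) (\sum_i a i).
Proof.
move=> H; elim: (index_enum I) => [|i s IH].
  rewrite big_nil (_ : (fun _ => _) = fun _ => 0); first exact: is_derive_const.
  by apply/funext => y; rewrite big_nil.
rewrite big_cons (_ : (fun _ => _) = fun y => f i y + \sum_(j <- s) f j y).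
  exact: is_derive_add.
by apply/funext => y; rewrite big_cons.
Qed.

End ScalarDerivatives.

(** * Chain rule along curves *)

Section ChainRule.
Context {R : realType} {N : nat}.
Implicit Types (f : 'cV[R]_N -> R) (p q v : 'cV[R]_N).

Lemma MVT_line_signed f v p (h : R) : (forall q, derivable f q v) ->
  exists2 s, 0 <= s <= 1 & f (h *: v + p) - f p = h * 'D_v f ((s * h) *: v + p).
Proof.
move=> df; have [->|h0] := eqVneq h 0.
  by exists 0; [rewrite lexx ler01|rewrite scale0r add0r mul0r subrr].
have [hp|hn] := leP 0 h.
  have [s /andP[s0 sh] E] := @MVT_line _ _ f v p h hp (fun s _ => df (s *: v + p)).
  exists (s / h); last by rewrite E mulfVK.
  by rewrite divr_ge0 //= ler_pdivrMr ?mul1r // lt_neqAle eq_sym h0.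
(* For negative [h] the segment is run backwards, from [h *: v + p] with step [- h]; the point [s]
   of that run has parameter [(s / h + 1) * h] on the original line. *)
have nh : 0 <= - h by rewrite oppr_ge0 ltW.
have [s /andP[s0 sh] E] := @MVT_line _ _ f v (h *: v + p) (- h) nh
  (fun s _ => df (s *: v + (h *: v + p))).
have E1 : - h *: v + (h *: v + p) = p.
  by rewrite scaleNr addrA addNr add0r.
have E2 : s *: v + (h *: v + p) = ((s / h + 1) * h) *: v + p.
  by rewrite mulrDl mulfVK // mul1r scalerDl addrA.
exists (s / h + 1).
  have h1 : 0 < - h by rewrite oppr_gt0.
  have hE : s / h = - (s / - h) by rewrite invrN mulrN opprK.
  have : 0 <= s / - h <= 1 by rewrite divr_ge0 //= ler_pdivrMr // mul1r.
  by rewrite hE => /andP[a b]; apply/andP; split; lra.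
by rewrite E1 E2 mulNr in E; rewrite -[LHS]opprB E opprK.
Qed.

(** Carathéodory's form of differentiability. Passing from [p] to [q] one coordinate at a time, the
    mean value theorem writes each increment as a partial derivative at an intermediate point, and
    continuity of the partials gives the limits. *)
Lemma increment_partials f p : Ck_on setT 1 f ->
  exists phi : 'I_N -> 'cV[R]_N -> R,
    (forall q, f q - f p = \sum_i phi i q * (q i 0 - p i 0)) /\
    forall i, phi i q @[q --> p] --> partial i f p.
Proof.
move=> f1.
have df i q : derivable f q (evec i) by apply: (f1.2 i).1.
(* The first [k] coordinates are those of [q], the others those of [p], so [mix 0] is [p], [mix N q]
   is [q], and the increments telescope. *)
pose mix (k : nat) q : 'cV[R]_N := \col_i if (i < k)%N then q i 0 else p i 0.
have mixS (i : 'I_N) q : mix i.+1 q = (q i 0 - p i 0) *: evec i + mix i q.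
  apply/matrixP => j k; rewrite !mxE ltnS ord1 eqxx andbT.
  case: ltngtP => [ji|ij|/val_inj ->].
  - rewrite (_ : (j == i) = false) ?mulr0 ?add0r //.
    by apply/negbTE; rewrite neq_ltn ji.
  - rewrite (_ : (j == i) = false) ?mulr0 ?add0r //.
    by apply/negbTE; rewrite neq_ltn ij orbT.
  - by rewrite eqxx mulr1 subrK.
have /choice[s sP] : forall x : 'I_N * 'cV[R]_N, exists s : R, 0 <= s <= 1 /\
    f (mix x.1.+1 x.2) - f (mix x.1 x.2) = (x.2 x.1 0 - p x.1 0) *
      'D_(evec x.1) f ((s * (x.2 x.1 0 - p x.1 0)) *: evec x.1 + mix x.1 x.2).
  move=> [i q] /=.
  have [s s01 E] := @MVT_line_signed f (evec i) (mix i q) (q i 0 - p i 0) (df i).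
  by exists s; split; [exact: s01|rewrite mixS; exact: E].
pose xi i q := (s (i, q) * (q i 0 - p i 0)) *: evec i + mix i q.
exists (fun i q => partial i f (xi i q)); split=> [q|i].
  transitivity (f (mix N q) - f (mix 0%N q)).
    congr (f _ - f _); apply/matrixP => a b; rewrite !mxE ord1 //.
    by rewrite ltn_ord.
  rewrite -(telescope_sumr (fun k => f (mix k q)) (leq0n N)) big_mkord.
  by apply: eq_bigr => i _; rewrite (sP (i, q)).2 mulrC.
have /cvgrPdist_lt cf : {for p, continuous (partial i f)}.
  by apply: (f1.2 i).2.1.
apply: (iffRL (@cvgrPdist_lt _ _ _ (nbhs p) _ _ _)) => e e0; have /near_cV[d d0 dP] := cf _ e0.
apply: (cV_near d0) => q qd; apply: dP.
(* Each coordinate of [xi i q] lies between those of [p] and [q], so in the sup norm [xi i q] is at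
   least as close to [p] as [q] is. *)
apply: le_lt_trans qd; apply: cV_norm_le => // j.
rewrite -[leLHS]normrN; apply: (le_trans _ (normr_coord_le (p - q) j)).
rewrite !mxE opprB eqxx andbT.
have [/andP[s0 s1] _] := sP (i, q).
case: eqVneq => [->|ji]; rewrite ?ltnn ?mulr1 ?mulr0 ?add0r.
  rewrite addrK normrM ger0_norm // distrC.
  by rewrite ler_piMl.
by case: ltnP => _; [rewrite distrC|rewrite subrr normr0].
Qed.

(** By [increment_partials] the difference quotient is a finite sum of products of a factor [phi i],
    continuous at [c s], and the difference quotient of one coordinate of [c]. *)
Lemma is_derive_along f (c : R -> 'cV[R]_N) (dc : 'I_N -> R) (s : R) :
  Ck_on setT 1 f -> (forall i, is_derive s 1 (fun r => c r i 0) (dc i)) ->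
  is_derive s 1 (fun r => f (c r)) (\sum_i partial i f (c s) * dc i).
Proof.
move=> f1 dcP.
have [phi [phiE phic]] := increment_partials (c s) f1.
have cc : {for s, continuous c}.
  have : derivable c s 1.
    by apply/derivable_mxP => i j; rewrite ord1; case: (dcP i).
  by move=> /derivable1_diffP/differentiable_continuous.
have sh : (fun h : R => h *: (1 : R) + s) @ 0^' --> s.
  rewrite -[X in _ --> X]add0r.
  apply: cvgD; last exact: cvg_cst.
  rewrite -[X in _ --> X](scale0r (1 : R)).
  apply: cvgZr_tmp; exact: cvg_within.
have main : (fun h : R => h^-1 *: (f (c (h *: 1 + s)) - f (c s))) @ 0^' -->
    \sum_i partial i f (c s) * dc i.
  have -> : (fun h : R => h^-1 *: (f (c (h *: 1 + s)) - f (c s))) =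
     (fun h : R => \sum_i phi i (c (h *: 1 + s)) *
        (h^-1 *: (c (h *: 1 + s) i 0 - c s i 0))).
    apply/funext => h; rewrite phiE scaler_sumr; apply: eq_bigr => i _.
    by rewrite /GRing.scale /= mulrCA.
  apply: cvg_big => [|i _]; first exact: add_continuous.
  apply: cvgM.
    apply: (cvg_comp (fun h : R => c (h *: (1 : R) + s)) (phi i)); last exact: phic.
    apply: (cvg_comp _ c sh); exact: cc.
  have [dci <-] := dcP i.
  exact: dci.
by apply: DeriveDef; [apply/cvg_ex; exists (\sum_i partial i f (c s) * dc i)
  |apply/cvg_lim => //].
Qed.

End ChainRule.

(** * The ambient metric and its Levi-Civita connection *)

Section Coordinates.
Context {R : realType} {N : nat}.
Implicit Types (f : 'cV[R]_N -> R) (p v x : 'cV[R]_N).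

Lemma is_derive_coord p v (i : 'I_N) : is_derive p v (Defs.coord i) (v i 0).
Proof.
have d : derivable (fun q : 'cV[R]_N => q) p v by exact: derivable_id.
apply: DeriveDef; first by move/derivable_mxP : d; apply.
have := derive_mx d; rewrite (@derive_id _ _ p v) => /matrixP/(_ i 0).
by rewrite mxE.
Qed.

Lemma partial_coord p (i j : 'I_N) : partial j (Defs.coord i) p = (i == j)%:R.
Proof.
by rewrite /partial; have [_ ->] := is_derive_coord p (evec j) i; rewrite mxE eqxx andbT.
Qed.

(** Taken as a sum of partials rather than as ['D_x f], so that linearity in [x] holds without any
    differentiability of [f]. *)
Definition dirderiv f p x : R := \sum_i partial i f p * x i 0.

Lemma sum_delta (I : finType) (i : I) (x : I -> R) : \sum_j (i == j)%:R * x j = x i.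
Proof.
rewrite (bigD1 i) //= eqxx mul1r big1 ?addr0 // => j /negbTE ji.
by rewrite eq_sym ji mul0r.
Qed.

Lemma dirderiv_coord p x i : dirderiv (Defs.coord i) p x = x i 0.
Proof.
rewrite -(sum_delta i (fun j => x j 0)).
by apply: eq_bigr => j _; rewrite partial_coord.
Qed.

Lemma differential_coord p (i j : 'I_N) : differential (Defs.coord i) p 0 j = (i == j)%:R.
Proof. by rewrite mxE partial_coord. Qed.

End Coordinates.

Section AmbientIndices.
Context {m : nat}.

Lemma adim_ind (P : 'I_(adim m) -> Prop) :
  P i_v -> P i_rho -> (forall A, P (i_x A)) -> P i_u -> P i_t -> forall i, P i.
Proof.
move=> Pv Pr Px Pu Pt i; case: (split_ordP i) => [j ->|j ->].
  have [->|->] : j = 0 \/ j = 1 by case: j => -[|[|//]] h; [left|right]; exact: val_inj.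
    exact: Pv.
  exact: Pr.
case: (split_ordP j) => [A ->|k ->]; first exact: Px.
have [->|->] : k = 0 \/ k = 1 by case: k => -[|[|//]] h; [left|right]; exact: val_inj.
  exact: Pu.
exact: Pt.
Qed.

Lemma adim_big (V : nmodType) (f : 'I_(adim m) -> V) :
  \sum_i f i = f i_v + f i_rho + \sum_A f (i_x A) + f i_u + f i_t.
Proof.
rewrite big_split_ord /= big_split_ord /= !big_ord_recl !big_ord0 !addr0 !addrA.
by have -> : lift ord0 ord0 = 1 :> 'I_2 by exact: val_inj.
Qed.

Lemma adim_eqE :
  (((@i_v m == i_v) = true) * ((@i_v m == i_rho) = false) * ((@i_v m == i_u) = false)
   * ((@i_v m == i_t) = false) * ((@i_rho m == i_v) = false)
   * ((@i_rho m == i_rho) = true) * ((@i_rho m == i_u) = false)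
   * ((@i_rho m == i_t) = false) * ((@i_u m == i_v) = false)
   * ((@i_u m == i_rho) = false) * ((@i_u m == i_u) = true)
   * ((@i_u m == i_t) = false) * ((@i_t m == i_v) = false)
   * ((@i_t m == i_rho) = false) * ((@i_t m == i_u) = false)
   * ((@i_t m == i_t) = true))%type
  * ((forall A : 'I_m, (i_x A == i_v) = false) * (forall A : 'I_m, (i_x A == i_rho) = false)
   * (forall A : 'I_m, (i_x A == i_u) = false) * (forall A : 'I_m, (i_x A == i_t) = false)
   * (forall A : 'I_m, (i_v == i_x A) = false) * (forall A : 'I_m, (i_rho == i_x A) = false)
   * (forall A : 'I_m, (i_u == i_x A) = false) * (forall A : 'I_m, (i_t == i_x A) = false)
   * (forall A B : 'I_m, (i_x A == i_x B) = (A == B)))%type.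
Proof.
rewrite /i_v /i_rho /i_u /i_t /i_x; do !split=> *; by rewrite !eq_shift.
Qed.

End AmbientIndices.

(** * Pulling F back to the ambient space *)

Section FArgs.
Context {R : realType} {m : nat}.
Implicit Types (f : 'cV[R]_(2 + m) -> R) (p q v w : 'cV[R]_(adim m)).

Lemma F_args_linear (h : R) v p : F_args (h *: v + p) = h *: F_args v + F_args p.
Proof.
apply/matrixP => i j; rewrite /F_args /Defs.coord !mxE.
by case: (fintype.split _) => k; rewrite !mxE //; case: ifP.
Qed.

Lemma F_args_norm p : `|F_args p| <= `|p|.
Proof.
apply: cV_norm_le => // i; rewrite /F_args /Defs.coord !mxE.
by case: (fintype.split _) => k; rewrite !mxE ?normr_coord_le //;
  case: ifP => _; exact: normr_coord_le.
Qed.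

Lemma F_args_continuous : continuous (@F_args R m).
Proof.
move=> p; apply: (iffRL (@cvgrPdist_lt _ _ _ (nbhs p) _ _ _)) => e e0.
apply: (cV_near e0) => q; apply: le_lt_trans.
have -> : F_args p - F_args q = F_args (p - q).
  by rewrite [p - q]addrC -(scaleN1r q) F_args_linear scaleN1r addrC.
exact: F_args_norm.
Qed.

Lemma derive_F_args f p v :
  'D_v (fun q => f (F_args q)) p = 'D_(F_args v) f (F_args p).
Proof.
rewrite /derive /=.
have -> // : (fun h : R => h^-1 *: (f (F_args (h *: v + p)) - f (F_args p))) =
          (fun h : R => h^-1 *: (f (h *: F_args v + F_args p) - f (F_args p))).
by apply/funext => h; rewrite F_args_linear.
Qed.

Lemma derivable_F_args f p v :
  derivable f (F_args p) (F_args v) -> derivable (fun q => f (F_args q)) p v.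
Proof.
rewrite /derivable /=.
have -> : (fun h : R => h^-1 *: (f (F_args (h *: v + p)) - f (F_args p))) =
          (fun h : R => h^-1 *: (f (h *: F_args v + F_args p) - f (F_args p))).
  by apply/funext => h; rewrite F_args_linear.
exact.
Qed.

Lemma F_args_evec0 (i : 'I_(adim m)) : i = i_v \/ i = i_t ->
  F_args (evec i) = 0 :> 'cV[R]_(2 + m).
Proof.
by case=> ->; apply/matrixP => j l; rewrite /F_args /Defs.coord !mxE;
  case: (fintype.split _) => k; rewrite !mxE ?adim_eqE //; case: ifP;
  rewrite ?mxE ?adim_eqE.
Qed.

Lemma F_args_evec (i : 'I_(adim m)) : F_args (evec i : 'cV[R]_(adim m)) = 0 \/
  exists k, F_args (evec i : 'cV[R]_(adim m)) = evec k.
Proof.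
have E (k : 'I_(2 + m)) (w : 'cV[R]_(2 + m)) :
    (forall j, w j 0 = (j == k)%:R) -> w = evec k.
  by move=> H; apply/matrixP => j l; rewrite ord1 H mxE eqxx andbT.
move: i; apply: adim_ind => [||A||].
- left; apply: F_args_evec0; tauto.
- right; exists (lshift m 0); apply: E => j; rewrite /F_args /Defs.coord !mxE.
  case: (split_ordP j) => k ->; rewrite !mxE !eq_shift.
    by case: (k == 0); rewrite ?mxE ?adim_eqE.
  by rewrite ?adim_eqE.
- right; exists (rshift 2 A); apply: E => j; rewrite /F_args /Defs.coord !mxE.
  case: (split_ordP j) => k ->; rewrite !mxE !eq_shift.
    by case: (k == 0); rewrite ?mxE ?adim_eqE.
  by rewrite ?adim_eqE eqxx andbT.
- right; exists (lshift m 1); apply: E => j; rewrite /F_args /Defs.coord !mxE.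
  case: (split_ordP j) => k ->; rewrite !mxE !eq_shift.
    by case: k => -[|[|//]] h; rewrite ?mxE ?adim_eqE.
  by rewrite ?adim_eqE.
- left; apply: F_args_evec0; tauto.
Qed.

(** The linear map [F_args] sends each coordinate vector to 0 or to a coordinate vector. Hence every
    partial of the pullback is again a pullback, of the zero function or of a partial of [f], and
    induction on [n] applies. *)
Lemma Ck_on_F_args n f :
  Ck_on setT n f -> Ck_on setT n (fun p => f (F_args p)).
Proof.
elim: n f => [|n IH] f /= [fc fd].
  by split=> // p _; exact: (continuous_comp (@F_args_continuous p) (fc _ I)).
split=> [p _|i]; first exact: (continuous_comp (@F_args_continuous p) (fc _ I)).
split=> [p _|].
  apply: derivable_F_args; have [->|[k ->]] := F_args_evec i.
    exact: derivable0.
  exact: (fd k).1.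
have [E|[k E]] := F_args_evec i.
  have -> : partial i (fun p => f (F_args p)) = (fun p => cst 0 (F_args p)).
    by apply/funext => p; rewrite /partial derive_F_args E derive0.
  have C0 : Ck_on (setT : set 'cV[R]_(2 + m)) n (cst 0).
    elim: n {IH fd} => [|n IH] /=; (split; first by move=> q _; exact: cst_continuous).
      by [].
    move=> k; split=> [q _|]; first exact: derivable_cst.
    have -> // : partial k (cst 0) = cst 0 :> ('cV[R]_(2 + m) -> R).
    by apply/funext => q; rewrite /partial derive_cst.
  exact: IH C0.
have -> : partial i (fun p => f (F_args p)) = (fun p => partial k f (F_args p)).
  by apply/funext => p; rewrite /partial derive_F_args E.
exact: IH (fd k).2.
Qed.

Lemma partial_F_args0 f p i : i = i_v \/ i = i_t ->
  partial i (fun q => f (F_args q)) p = 0.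
Proof. by move=> /F_args_evec0 E; rewrite /partial derive_F_args E derive0. Qed.

End FArgs.

(** * The metric as a combination of four constant forms *)

Section Metric.
Context {R : realType} {m : nat}.
Variable F : 'cV[R]_(2 + m) -> R.
Implicit Types (p q v w x z : 'cV[R]_(adim m)) (i j k l : 'I_(adim m)).
Local Notation g := (ambient_metric F).
Local Notation dl := (fun i j => (i == j)%:R : R).

(** Gram matrices of 2 drho dt, 2 dt^2, 2 du dv + sum of (dx^A)^2, and 2 du^2. Since 2 d(t rho) dt =
    2 t drho dt + 2 rho dt^2, the metric combines these constant matrices with the factors t, rho,
    t^2 and t^2 F. *)
Definition coef_t i j : R := dl i_rho i * dl i_t j + dl i_t i * dl i_rho j.
Definition coef_rho i j : R := 2 * dl i_t i * dl i_t j.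
Definition coef_tt i j : R := dl i_u i * dl i_v j + dl i_v i * dl i_u j
  + \sum_A dl (i_x A) i * dl (i_x A) j.
Definition coef_ttG i j : R := 2 * dl i_u i * dl i_u j.

Lemma symprodE (a b : 'rV[R]_(adim m)) i j :
  symprod a b i j = 2^-1 * (a 0 i * b 0 j + b 0 i * a 0 j).
Proof. by rewrite /symprod !mxE !big_ord1 !mxE. Qed.

Lemma differential_t_rho p j :
  differential (fun q => Defs.coord i_t q * Defs.coord i_rho q) p 0 j
  = Defs.coord i_t p * dl i_rho j + Defs.coord i_rho p * dl i_t j.
Proof.
rewrite mxE /partial.
have d1 := is_derive_coord p (evec j) i_t.
have d2 := is_derive_coord p (evec j) i_rho.
have [_ ->] := is_deriveM d1 d2.
by rewrite !mxE !eqxx !andbT.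
Qed.

Lemma metricE p i j : g p i j = p i_t 0 * coef_t i j + p i_rho 0 * coef_rho i j
  + p i_t 0 ^+ 2 * coef_tt i j + p i_t 0 ^+ 2 * F (F_args p) * coef_ttG i j.
Proof.
have addE (A B : 'M[R]_(adim m)) : (A + B) i j = A i j + B i j by rewrite mxE.
have scaleE c (A : 'M[R]_(adim m)) : (c *: A) i j = c * A i j by rewrite mxE.
rewrite /ambient_metric addE scaleE symprodE scaleE addE scaleE symprodE summxE.
move: (differential (fun _ => _ * _) p) (differential_t_rho p) => dtr dtrE.
rewrite !dtrE.
have rowE (a b : 'rV[R]_(adim m)) c k : (a + c *: b) 0 k = a 0 k + c * b 0 k.
  by rewrite !mxE.
rewrite !rowE !differential_coord.
have -> : \sum_A symprod (differential (Defs.coord (i_x A)) p)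
              (differential (Defs.coord (i_x A)) p) i j
    = \sum_A dl (i_x A) i * dl (i_x A) j.
  apply: eq_bigr => A _; rewrite symprodE !differential_coord.
  by move: (_ == i) (_ == j) => a b; field.
rewrite /coef_t /coef_rho /coef_tt /coef_ttG /Defs.coord.
by move: (F _) (\sum_A _) => Fp S; field.
Qed.

End Metric.

Section Christoffel.
Context {R : realType} {m : nat}.
Variable F : 'cV[R]_(2 + m) -> R.
Hypothesis F_C1 : Ck_on setT 1 F.
Implicit Types (p q v w x z : 'cV[R]_(adim m)) (i j k l : 'I_(adim m)).
Local Notation N := (adim m).
Local Notation G := (fun p => F (F_args p)).
Local Notation g := (ambient_metric F).
Local Notation dl := (fun i j => (i == j)%:R : R).

Lemma sum_deltar (i : 'I_N) (x : 'I_N -> R) : \sum_j x j * (i == j)%:R = x i.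
Proof. by under eq_bigr do rewrite mulrC; exact: sum_delta. Qed.

Definition lower_t z l : R := z i_rho 0 * dl i_t l + z i_t 0 * dl i_rho l.
Definition lower_rho z l : R := 2 * z i_t 0 * dl i_t l.
Definition lower_tt z l : R := z i_u 0 * dl i_v l + z i_v 0 * dl i_u l
  + \sum_A z (i_x A) 0 * dl (i_x A) l.
Definition lower_ttG z l : R := 2 * z i_u 0 * dl i_u l.

Lemma sum_coef_t z l : \sum_j coef_t j l * z j 0 = lower_t z l.
Proof.
rewrite /coef_t /lower_t; under eq_bigr do rewrite mulrDl -!mulrA.
by rewrite big_split /= !sum_delta [z _ _ * _]mulrC [z i_t _ * _]mulrC.
Qed.

Lemma sum_coef_rho z l : \sum_j coef_rho j l * z j 0 = lower_rho z l.
Proof.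
rewrite /coef_rho /lower_rho; under eq_bigr do rewrite -!mulrA mulrCA.
by rewrite sum_delta; ring.
Qed.

Lemma sum_coef_ttG z l : \sum_j coef_ttG j l * z j 0 = lower_ttG z l.
Proof.
rewrite /coef_ttG /lower_ttG; under eq_bigr do rewrite -!mulrA mulrCA.
by rewrite sum_delta; ring.
Qed.

Lemma sum_coef_tt z l : \sum_j coef_tt j l * z j 0 = lower_tt z l.
Proof.
rewrite /coef_tt /lower_tt; under eq_bigr do rewrite !mulrDl -!mulrA mulr_suml.
rewrite !big_split /= !sum_delta; congr (_ + _); first by congr (_ + _); exact: mulrC.
rewrite exchange_big /=; apply: eq_bigr => A _.
by under eq_bigr do rewrite -mulrA; rewrite sum_delta mulrC.
Qed.

Lemma metric_sym p i j : g p i j = g p j i.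
Proof.
rewrite !metricE /coef_t /coef_rho /coef_tt /coef_ttG.
under [in RHS]eq_bigr do rewrite mulrC.
by move: (F _) (\sum_A _) => Fp S; ring.
Qed.

Lemma sum_metric p w l : \sum_j g p l j * w j 0
  = p i_t 0 * lower_t w l + p i_rho 0 * lower_rho w l + p i_t 0 ^+ 2 * lower_tt w l
    + p i_t 0 ^+ 2 * F (F_args p) * lower_ttG w l.
Proof.
rewrite -sum_coef_t -sum_coef_rho -sum_coef_tt -sum_coef_ttG !mulr_sumr -!big_split.
apply: eq_bigr => j _; rewrite metric_sym metricE /=.
by move: (F _) (coef_t _ _) (coef_rho _ _) (coef_tt _ _) (coef_ttG _ _) => *; ring.
Qed.

Lemma G_C1 : Ck_on setT 1 G.
Proof. exact: Ck_on_F_args. Qed.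

Lemma derivable_G p i : derivable G p (evec i).
Proof. exact: (G_C1.2 i).1. Qed.

Lemma partial_metric i j k p : partial k (fun q => g q i j) p
  = dl i_t k * coef_t i j + dl i_rho k * coef_rho i j
    + 2 * p i_t 0 * dl i_t k * (coef_tt i j + F (F_args p) * coef_ttG i j)
    + p i_t 0 ^+ 2 * partial k G p * coef_ttG i j.
Proof.
have -> : (fun q => g q i j) = (fun q => Defs.coord i_t q * coef_t i j
    + Defs.coord i_rho q * coef_rho i j + Defs.coord i_t q * Defs.coord i_t q *
      (coef_tt i j + F (F_args q) * coef_ttG i j)).
  by apply/funext => q; rewrite metricE; move: (F _) => Fq; rewrite /Defs.coord; ring.
have dt : is_derive p (evec k) (Defs.coord i_t) (dl i_t k).
  by have := is_derive_coord p (evec k) (@i_t m); rewrite mxE eqxx andbT.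
have dr : is_derive p (evec k) (Defs.coord i_rho) (dl i_rho k).
  by have := is_derive_coord p (evec k) (@i_rho m); rewrite mxE eqxx andbT.
have dG : is_derive p (evec k) G (partial k G p).
  by apply: DeriveDef => //; exact: derivable_G.
have [_ E] := is_derive_add (is_derive_add
    (is_derive_mul dt (is_derive_const (coef_t i j) p (evec k)))
    (is_derive_mul dr (is_derive_const (coef_rho i j) p (evec k))))
  (is_derive_mul (is_derive_mul dt dt)
    (is_derive_add (is_derive_const (coef_tt i j) p (evec k))
      (is_derive_mul dG (is_derive_const (coef_ttG i j) p (evec k))))).
apply: etrans E _; rewrite /Defs.coord.
move: (partial _ _ _) (F _) (coef_tt _ _) (coef_ttG _ _) (coef_t _ _) (coef_rho _ _).
by move=> *; ring.
Qed.

End Christoffel.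

Section ChristoffelFormula.
Context {R : realType} {m : nat}.
Variable F : 'cV[R]_(2 + m) -> R.
Implicit Types (p q v w x z : 'cV[R]_(adim m)) (i j k l : 'I_(adim m)).
Local Notation N := (adim m).
Local Notation g := (ambient_metric F).
Local Notation dl := (fun i j => (i == j)%:R : R).

Lemma lower_tE z : ((lower_t z i_v = 0) * (lower_t z i_rho = z i_t 0)
  * (forall A, lower_t z (i_x A) = 0) * (lower_t z i_u = 0)
  * (lower_t z i_t = z i_rho 0))%type.
Proof.
by rewrite /lower_t; do !split=> *; rewrite !adim_eqE ?mulr0 ?mulr1 ?addr0 ?add0r.
Qed.

Lemma lower_rhoE z : ((lower_rho z i_v = 0) * (lower_rho z i_rho = 0)
  * (forall A, lower_rho z (i_x A) = 0) * (lower_rho z i_u = 0)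
  * (lower_rho z i_t = (2 * z i_t 0)%R))%type.
Proof.
by rewrite /lower_rho; do !split=> *; rewrite !adim_eqE ?mulr0 ?mulr1.
Qed.

Lemma lower_ttE z : ((lower_tt z i_v = z i_u 0) * (lower_tt z i_rho = 0)
  * (forall A, lower_tt z (i_x A) = z (i_x A) 0) * (lower_tt z i_u = z i_v 0)
  * (lower_tt z i_t = 0))%type.
Proof.
have S0 k : (forall A, i_x A == k = false) -> \sum_A z (i_x A) 0 * dl (i_x A) k = 0.
  by move=> H; rewrite big1 // => A _; rewrite H mulr0.
have Sx B : \sum_A z (i_x A) 0 * dl (i_x A) (i_x B) = z (i_x B) 0.
  under eq_bigr do rewrite adim_eqE eq_sym mulrC.
  exact: (sum_delta B (fun A => z (i_x A) 0)).
rewrite /lower_tt; do !split=> *; rewrite ?Sx ?(S0 i_v) ?(S0 i_rho) ?(S0 i_u) ?(S0 i_t);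
  rewrite ?adim_eqE ?mulr0 ?mulr1 ?addr0 ?add0r // => A; by rewrite adim_eqE.
Qed.

Lemma lower_ttGE z : ((lower_ttG z i_v = 0) * (lower_ttG z i_rho = 0)
  * (forall A, lower_ttG z (i_x A) = 0) * (lower_ttG z i_u = (2 * z i_u 0)%R)
  * (lower_ttG z i_t = 0))%type.
Proof.
by rewrite /lower_ttG; do !split=> *; rewrite !adim_eqE ?mulr0 ?mulr1.
Qed.

Definition lowerE z := (lower_tE z, lower_rhoE z, lower_ttE z, lower_ttGE z).

Lemma metric_mulE p z k : (g p *m z) k 0
  = p i_t 0 * lower_t z k + p i_rho 0 * lower_rho z k + p i_t 0 ^+ 2 * lower_tt z k
    + p i_t 0 ^+ 2 * F (F_args p) * lower_ttG z k.
Proof. by rewrite mxE sum_metric. Qed.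

Lemma innerE p x z : inner g p x z =
  p i_t 0 * (x i_rho 0 * z i_t 0 + x i_t 0 * z i_rho 0)
  + 2 * p i_rho 0 * x i_t 0 * z i_t 0
  + p i_t 0 ^+ 2 * (x i_u 0 * z i_v 0 + x i_v 0 * z i_u 0
      + \sum_A x (i_x A) 0 * z (i_x A) 0 + 2 * F (F_args p) * x i_u 0 * z i_u 0).
Proof.
rewrite /inner -mulmxA mxE; under eq_bigr do rewrite mxE metric_mulE.
rewrite adim_big !lowerE.
have -> : \sum_A x (i_x A) 0 * (p i_t 0 * lower_t z (i_x A) + p i_rho 0 * lower_rho z (i_x A)
    + p i_t 0 ^+ 2 * lower_tt z (i_x A) + p i_t 0 ^+ 2 * F (F_args p) * lower_ttG z (i_x A))
    = p i_t 0 ^+ 2 * \sum_A x (i_x A) 0 * z (i_x A) 0.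
  rewrite mulr_sumr; apply: eq_bigr => A _; rewrite !lowerE.
  by rewrite !mulr0 !add0r addr0 mulrCA.
by move: (F _) (\sum_A _) => *; ring.
Qed.

Lemma block_metricE i j : (block_metric : 'M[R]_N) i j =
  dl i_v i * dl i_u j + dl i_u i * dl i_v j + dl i_rho i * dl i_t j
  + dl i_t i * dl i_rho j + \sum_A dl (i_x A) i * dl (i_x A) j.
Proof.
have Sl i' j' : (forall A, i_x A == i' = false) -> \sum_A dl (i_x A) i' * dl (i_x A) j' = 0.
  by move=> H; rewrite big1 // => A _; rewrite H mul0r.
have Sr i' j' : (forall A, i_x A == i' = false) -> \sum_A dl (i_x A) j' * dl (i_x A) i' = 0.
  by move=> H; rewrite big1 // => A _; rewrite H mulr0.
have Sx A B : \sum_C dl (i_x C) (i_x A) * dl (i_x C) (i_x B) = (A == B)%:R.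
  under eq_bigr do rewrite !adim_eqE eq_sym.
  by rewrite (sum_delta A (fun C => (C == B)%:R)).
move: j; move: i; apply: adim_ind => [||A||]; apply: adim_ind => [||B||];
  rewrite ?(Sl i_v) ?(Sl i_rho) ?(Sl i_u) ?(Sl i_t) ?(Sr i_v) ?(Sr i_rho) ?(Sr i_u)
    ?(Sr i_t) ?Sx; try by move=> *; rewrite adim_eqE.
all: rewrite !adim_eqE /block_metric /block_mx /i_v /i_rho /i_x /i_u /i_t
    ?(col_mxEu, col_mxEd, row_mxEl, row_mxEr) ?mxE /=.
all: by rewrite ?mulr0 ?mul0r ?mulr1 ?addr0 ?add0r.
Qed.

(** The block metric is the ambient metric formula at t = 1, rho = 0, F = 0, so the contraction
    lemmas of the constant forms apply to it. *)
Lemma block_metric_sum i j : (block_metric : 'M[R]_N) i j = coef_t i j + coef_tt i j.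
Proof. by rewrite block_metricE /coef_t /coef_tt; move: (\sum_A _) => S; ring. Qed.

Lemma block_metric_rowE j : (((block_metric : 'M[R]_N) i_v j = dl i_u j)
  * ((block_metric : 'M[R]_N) i_rho j = dl i_t j)
  * (forall A, (block_metric : 'M[R]_N) (i_x A) j = dl (i_x A) j)
  * ((block_metric : 'M[R]_N) i_u j = dl i_v j)
  * ((block_metric : 'M[R]_N) i_t j = dl i_rho j))%type.
Proof.
have S0 i : (forall A, i_x A == i = false) -> \sum_A dl (i_x A) i * dl (i_x A) j = 0.
  by move=> H; rewrite big1 // => A _; rewrite H mul0r.
have Sx B : \sum_A dl (i_x A) (i_x B) * dl (i_x A) j = dl (i_x B) j.
  under eq_bigr do rewrite adim_eqE eq_sym.
  exact: (sum_delta B (fun A => dl (i_x A) j)).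
do !split=> *; rewrite block_metricE ?Sx ?(S0 i_v) ?(S0 i_rho) ?(S0 i_u) ?(S0 i_t);
  rewrite ?adim_eqE ?mul0r ?mul1r ?addr0 ?add0r // => A; by rewrite adim_eqE.
Qed.

(** The matrix is the permutation that swaps v with u and rho with t, hence its own inverse. *)
Lemma block_metric_unit : (block_metric : 'M[R]_N) \in unitmx.
Proof.
suff /mulmx1_unit[] // : block_metric *m block_metric = 1%:M :> 'M[R]_N by [].
apply/matrixP => i j; rewrite mxE [RHS]mxE.
have Hsym k : (block_metric : 'M[R]_N) i k = (block_metric : 'M[R]_N) k i.
  rewrite !block_metricE; under [in RHS]eq_bigr do rewrite mulrC.
  by move: (\sum_A _) => S; ring.
have colE k : (block_metric : 'M[R]_N) k j = col j block_metric k 0 by rewrite [RHS]mxE.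
transitivity (\sum_k (coef_t k i * (col j block_metric : 'cV[R]_N) k 0
    + coef_tt k i * (col j block_metric : 'cV[R]_N) k 0)).
  by apply: eq_bigr => k _; rewrite Hsym block_metric_sum colE mulrDl.
rewrite big_split /= sum_coef_t sum_coef_tt.
by move: i {Hsym}; apply: adim_ind => [||A||];
  rewrite lower_tE lower_ttE mxE block_metric_rowE ?add0r ?addr0.
Qed.

(* The columns are d_v, d_rho, d_A / t, (d_u - F d_v) / t^2 and
   (d_t - (rho / t) d_rho) / t. *)
Definition frame p : 'M[R]_N := \matrix_(k, j)
  (dl i_v k * (dl i_v j - F (F_args p) / p i_t 0 ^+ 2 * dl i_u j)
   + dl i_rho k * (dl i_rho j - p i_rho 0 / p i_t 0 ^+ 2 * dl i_t j)
   + \sum_A dl (i_x A) k * dl (i_x A) j / p i_t 0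
   + dl i_u k * dl i_u j / p i_t 0 ^+ 2 + dl i_t k * dl i_t j / p i_t 0).

Lemma frameE p j :
  ((frame p i_v j = (dl i_v j - F (F_args p) / p i_t 0 ^+ 2 * dl i_u j)%R)
   * (frame p i_rho j = (dl i_rho j - p i_rho 0 / p i_t 0 ^+ 2 * dl i_t j)%R)
   * (forall A, frame p (i_x A) j = (dl (i_x A) j / p i_t 0)%R)
   * (frame p i_u j = (dl i_u j / p i_t 0 ^+ 2)%R)
   * (frame p i_t j = (dl i_t j / p i_t 0)%R))%type.
Proof.
have S0 i : (forall A, i_x A == i = false) ->
    \sum_A dl (i_x A) i * dl (i_x A) j / p i_t 0 = 0.
  by move=> H; rewrite big1 // => A _; rewrite H !mul0r.
have Sx B : \sum_A dl (i_x A) (i_x B) * dl (i_x A) j / p i_t 0 = dl (i_x B) j / p i_t 0.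
  under eq_bigr do rewrite adim_eqE eq_sym -mulrA.
  exact: (sum_delta B (fun A => dl (i_x A) j / p i_t 0)).
do !split=> *; rewrite mxE ?Sx ?(S0 i_v) ?(S0 i_rho) ?(S0 i_u) ?(S0 i_t);
  rewrite ?adim_eqE ?mul0r ?mul1r ?addr0 ?add0r // => A; by rewrite adim_eqE.
Qed.

Lemma frame_metric p : 0 < p i_t 0 -> (frame p)^T *m g p *m frame p = block_metric.
Proof.
move=> t0; apply/matrixP => i j.
have -> : ((frame p)^T *m g p *m frame p) i j = inner g p (col i (frame p)) (col j (frame p)).
  rewrite /inner -!mulmxA mxE [RHS]mxE.
  by apply: eq_bigr => k _; rewrite !mxE; congr (_ * _); apply: eq_bigr => l _; rewrite !mxE.
have cE k l : col l (frame p) k 0 = frame p k l by rewrite mxE.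
rewrite innerE !cE !frameE block_metricE.
have -> : \sum_A col i (frame p) (i_x A) 0 * col j (frame p) (i_x A) 0
    = (\sum_A dl (i_x A) i * dl (i_x A) j) / p i_t 0 ^+ 2.
  rewrite mulr_suml; apply: eq_bigr => A _; rewrite !cE !frameE; field.
  exact: lt0r_neq0.
move: (\sum_A _) (F _) => S Fp; field.
exact: lt0r_neq0.
Qed.

(** [frame_metric] exhibits the invertible [block_metric] as a product with [g p] as a factor. *)
Lemma metric_unit p : 0 < p i_t 0 -> g p \in unitmx.
Proof.
move=> /frame_metric E; move: block_metric_unit; rewrite -E !unitmx_mul.
by case/andP => /andP[].
Qed.

(** Makes (iii) non-vacuous. The first two columns of [frame p] are d_v and d_rho themselves,
    unscaled. *)
Lemma adapted_frame p : 0 < p i_t 0 -> adapted_basis g p (frame p).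
Proof.
move=> t0; have E := frame_metric t0; split=> //.
  by move: block_metric_unit; rewrite -E !unitmx_mul; case/andP.
move=> w.
have frame_v k : frame p k i_v = (k == i_v)%:R.
  move: k; apply: adim_ind => [||A||]; rewrite frameE !adim_eqE;
    by rewrite ?mul0r ?mulr0 ?subr0.
have frame_rho k : frame p k i_rho = (k == i_rho)%:R.
  move: k; apply: adim_ind => [||A||]; rewrite frameE !adim_eqE;
    by rewrite ?mul0r ?mulr0 ?subr0.
have key (c : 'cV[R]_2) : lsubmx (frame p) *m c = c 0 0 *: evec i_v + c 1 0 *: evec i_rho.
  apply/matrixP => k l; rewrite mxE ord1 big_ord_recl big_ord1.
  have -> : lift ord0 ord0 = 1 :> 'I_2 by exact: val_inj.
  have sE (j : 'I_2) : lsubmx (frame p) k j = frame p k (lshift (m + 2) j) by rewrite [LHS]mxE.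
  rewrite !sE -[lshift _ 1]/i_rho -[lshift _ ord0]/i_v.
  by rewrite frame_v frame_rho !mxE eqxx !andbT mulrC [_ * c 1 0]mulrC.
split=> [[a [b ->]]|[c ->]]; last by exists (c 0 0), (c 1 0).
exists (\col_k if k == 0 then a else b).
by rewrite key !mxE.
Qed.

End ChristoffelFormula.

(** * The Christoffel form *)

Section LeviCivita.
Context {R : realType} {m : nat}.
Variable F : 'cV[R]_(2 + m) -> R.
Hypothesis F_C1 : Ck_on setT 1 F.
Implicit Types (p q v w x z : 'cV[R]_(adim m)) (i j k l : 'I_(adim m)).
Local Notation N := (adim m).
Local Notation G := (fun p => F (F_args p)).
Local Notation g := (ambient_metric F).
Local Notation dl := (fun i j => (i == j)%:R : R).
Local Notation dG := (dirderiv G).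

(** The value of Gamma^k_ij x^i z^j, stated as a candidate and justified by [lowered_christoffel].
    The first summand comes from the scaling in t; in the t row the last line cancels it and leaves
    only the term with the rho-derivative of F. *)
Definition christoffel_form p x z : 'cV[R]_N := \col_k
  ((z i_t 0 * x k 0 + x i_t 0 * z k 0) / p i_t 0
   + dl i_v k * (z i_u 0 * dG p x + x i_u 0 * dG p z - x i_u 0 * z i_u 0 * partial i_u G p)
   + dl i_rho k * (2 * p i_rho 0 * partial i_rho G p * x i_u 0 * z i_u 0
       - (x i_v 0 * z i_u 0 + x i_u 0 * z i_v 0 + \sum_A x (i_x A) 0 * z (i_x A) 0
          + 2 * F (F_args p) * x i_u 0 * z i_u 0))
   - \sum_A dl (i_x A) k * (x i_u 0 * z i_u 0 * partial (i_x A) G p)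
   - dl i_t k * (2 * x i_t 0 * z i_t 0 / p i_t 0
       + p i_t 0 * partial i_rho G p * x i_u 0 * z i_u 0)).

Lemma christoffel_formE p x z :
  ((christoffel_form p x z i_v 0 = ((z i_t 0 * x i_v 0 + x i_t 0 * z i_v 0) / p i_t 0
      + (z i_u 0 * dG p x + x i_u 0 * dG p z - x i_u 0 * z i_u 0 * partial i_u G p))%R)
  * (christoffel_form p x z i_rho 0 = ((z i_t 0 * x i_rho 0 + x i_t 0 * z i_rho 0) / p i_t 0
      + (2 * p i_rho 0 * partial i_rho G p * x i_u 0 * z i_u 0
       - (x i_v 0 * z i_u 0 + x i_u 0 * z i_v 0 + \sum_A x (i_x A) 0 * z (i_x A) 0
          + 2 * F (F_args p) * x i_u 0 * z i_u 0)))%R)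
  * (forall A, christoffel_form p x z (i_x A) 0 =
      ((z i_t 0 * x (i_x A) 0 + x i_t 0 * z (i_x A) 0) / p i_t 0
      - x i_u 0 * z i_u 0 * partial (i_x A) G p)%R)
  * (christoffel_form p x z i_u 0 = ((z i_t 0 * x i_u 0 + x i_t 0 * z i_u 0) / p i_t 0)%R)
  * (christoffel_form p x z i_t 0 = (- (p i_t 0 * partial i_rho G p * x i_u 0 * z i_u 0))%R))%type.
Proof.
have S0 k : (forall A, i_x A == k = false) ->
    \sum_A dl (i_x A) k * (x i_u 0 * z i_u 0 * partial (i_x A) G p) = 0.
  by move=> H; rewrite big1 // => A _; rewrite H !mul0r.
have Sx B : \sum_A dl (i_x A) (i_x B) * (x i_u 0 * z i_u 0 * partial (i_x A) G p)
    = x i_u 0 * z i_u 0 * partial (i_x B) G p.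
  under eq_bigr do rewrite adim_eqE eq_sym.
  exact: (sum_delta B (fun A => x i_u 0 * z i_u 0 * partial (i_x A) G p)).
do !split=> *; rewrite mxE ?Sx ?(S0 i_v) ?(S0 i_rho) ?(S0 i_u) ?(S0 i_t);
  rewrite ?adim_eqE ?mul0r ?mul1r ?subr0 ?addr0 ?add0r //;
  try (by move=> A; rewrite adim_eqE).
by move: (partial _ _ _) => Gr; ring.
Qed.

Lemma sum_partial_metric p k z l : \sum_j partial k (fun q => g q j l) p * z j 0
  = dl i_t k * (lower_t z l + 2 * p i_t 0 * (lower_tt z l + F (F_args p) * lower_ttG z l))
    + dl i_rho k * lower_rho z l + partial k G p * (p i_t 0 ^+ 2 * lower_ttG z l).
Proof.
rewrite -sum_coef_t -sum_coef_rho -sum_coef_tt -sum_coef_ttG.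
do ?rewrite mulr_sumr -?big_split /=.
apply: eq_bigr => j _; rewrite partial_metric //.
by move: (partial _ _ _) (F _) (coef_tt _ _) (coef_ttG _ _) (coef_t _ _) (coef_rho _ _) => *; ring.
Qed.

(** First and third terms of the Koszul formula, contracted with [x] and [z]; the second term is
    [lowered1 p z x l]. *)
Definition lowered1 p x z l : R :=
  \sum_i \sum_j partial i (fun q => g q j l) p * x i 0 * z j 0.
Definition lowered3 p x z l : R :=
  \sum_i \sum_j partial l (fun q => g q i j) p * x i 0 * z j 0.

Lemma lowered1E p x z l : lowered1 p x z l =
  x i_t 0 * (lower_t z l + 2 * p i_t 0 * (lower_tt z l + F (F_args p) * lower_ttG z l))
    + x i_rho 0 * lower_rho z l + dG p x * (p i_t 0 ^+ 2 * lower_ttG z l).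
Proof.
transitivity (\sum_i (dl i_t i * (x i 0 * (lower_t z l
      + 2 * p i_t 0 * (lower_tt z l + F (F_args p) * lower_ttG z l)))
    + dl i_rho i * (x i 0 * lower_rho z l)
    + partial i G p * x i 0 * (p i_t 0 ^+ 2 * lower_ttG z l))).
  apply: eq_bigr => i _.
  transitivity (x i 0 * \sum_j partial i (fun q => g q j l) p * z j 0).
    by rewrite mulr_sumr; apply: eq_bigr => j _; rewrite mulrAC mulrC.
  rewrite sum_partial_metric.
  by move: (partial _ _ _) (F _) (lower_t _ _) (lower_tt _ _) (lower_ttG _ _)
    (lower_rho _ _) => *; ring.
rewrite !big_split /= /dirderiv mulr_suml.
by rewrite (sum_delta i_t (fun i => x i 0 * _)) (sum_delta i_rho (fun i => x i 0 * _)).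
Qed.

Lemma lowered3E p x z l : lowered3 p x z l =
  dl i_t l * ((x i_rho 0 * z i_t 0 + x i_t 0 * z i_rho 0)
     + 2 * p i_t 0 * ((x i_u 0 * z i_v 0 + x i_v 0 * z i_u 0
        + \sum_A x (i_x A) 0 * z (i_x A) 0) + F (F_args p) * (2 * x i_u 0 * z i_u 0)))
   + dl i_rho l * (2 * x i_t 0 * z i_t 0)
   + partial l G p * (p i_t 0 ^+ 2 * (2 * x i_u 0 * z i_u 0)).
Proof.
rewrite /lowered3 exchange_big /=.
transitivity (\sum_j z j 0 * \sum_i partial l (fun q => g q i j) p * x i 0).
  by apply: eq_bigr => j _; rewrite mulr_sumr; apply: eq_bigr => i _; rewrite mulrC.
rewrite (eq_bigr _ (fun j _ => congr1 ( *%R (z j 0)) (sum_partial_metric p l x j))).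
rewrite adim_big !lowerE.
have -> : \sum_A z (i_x A) 0 * (dl i_t l * (lower_t x (i_x A) + 2 * p i_t 0 * (lower_tt x (i_x A)
      + F (F_args p) * lower_ttG x (i_x A))) + dl i_rho l * lower_rho x (i_x A)
      + partial l G p * (p i_t 0 ^+ 2 * lower_ttG x (i_x A)))
    = dl i_t l * 2 * p i_t 0 * \sum_A x (i_x A) 0 * z (i_x A) 0.
  rewrite mulr_sumr; apply: eq_bigr => A _; rewrite !lowerE.
  by move: (partial _ _ _) (F _) => *; ring.
by move: (\sum_A _) (partial _ _ _) (F _) => *; ring.
Qed.

Lemma lowered_christoffel p x z l : 0 < p i_t 0 ->
  2^-1 * (lowered1 p x z l + lowered1 p z x l - lowered3 p x z l)
  = (g p *m christoffel_form p x z) l 0.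
Proof.
move=> t0; have tn0 := lt0r_neq0 t0.
have [tE fE] : true%:R = 1 :> R /\ false%:R = 0 :> R by [].
rewrite metric_mulE !lowered1E lowered3E.
move: l; apply: adim_ind => [||A||]; rewrite !lowerE !christoffel_formE ?adim_eqE ?tE ?fE
  ?(partial_F_args0 F p (or_introl (erefl _))) ?(partial_F_args0 F p (or_intror (erefl _))).
all: move: (\sum_A _) (partial i_rho G p) (partial i_u G p) (dG p x) (dG p z) (F _).
- by move=> *; field.
- by move=> *; field.
- by move: (partial _ _ _) => ? *; field.
- by move=> *; field.
- by move=> *; field.
Qed.

(** [lowered_christoffel] multiplied by the inverse metric, of which only the cancellation against
    [g p] enters. *)
Lemma christoffelE p x z k : 0 < p i_t 0 ->
  \sum_i \sum_j christoffel g k i j p * x i 0 * z j 0 = christoffel_form p x z k 0.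
Proof.
move=> t0.
rewrite -[christoffel_form p x z](mulKmx (metric_unit F t0)) mxE.
transitivity (\sum_l invmx (g p) k l *
    (2^-1 * (lowered1 p x z l + lowered1 p z x l - lowered3 p x z l))); last first.
  by apply: eq_bigr => l _; rewrite lowered_christoffel.
transitivity (\sum_l invmx (g p) k l * (\sum_i \sum_j 2^-1 *
    (partial i (fun q => g q j l) p + partial j (fun q => g q i l) p
     - partial l (fun q => g q i j) p) * x i 0 * z j 0)).
  under [RHS]eq_bigr do rewrite mulr_sumr; rewrite [RHS]exchange_big /=.
  apply: eq_bigr => i _.
  under [RHS]eq_bigr do rewrite mulr_sumr; rewrite [RHS]exchange_big /=.
  apply: eq_bigr => j _; rewrite /christoffel mulr_sumr !mulr_suml.
  apply: eq_bigr => l _.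
  by move: (invmx _ _ _) (partial _ _ _) (partial _ _ _) (partial _ _ _) => *; ring.
apply: eq_bigr => l _; congr (_ * _).
have -> : lowered1 p z x l = \sum_i \sum_j partial j (fun q => g q i l) p * x i 0 * z j 0.
  rewrite /lowered1 exchange_big /=; apply: eq_bigr => i _; apply: eq_bigr => j _.
  by rewrite mulrAC.
rewrite /lowered1 /lowered3 -!big_split /= -sumrB mulr_sumr.
apply: eq_bigr => i _; rewrite -!big_split /= -sumrB mulr_sumr.
apply: eq_bigr => j _; move: (partial _ _ _) (partial _ _ _) (partial _ _ _) => *; ring.
Qed.

End LeviCivita.

(** * Curvature *)

Section DirectionalDerivatives.
Context {R : realType} {N : nat}.
Implicit Types (U : set 'cV[R]_N) (f g : 'cV[R]_N -> R) (p q x : 'cV[R]_N).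
Implicit Types (X Y Z : 'cV[R]_N -> 'cV[R]_N).

Lemma partial_eq_on U f g p i : open U -> U p -> (forall q, U q -> f q = g q) ->
  partial i f p = partial i g p.
Proof.
move=> oU Up fg; apply: near_eq_derive.
have Un : \forall q \near p, U q by exact: open_nbhs_nbhs.
by apply: filterS Un => q; exact: fg.
Qed.

Lemma derivable_eq_on U f g p i : open U -> U p -> (forall q, U q -> f q = g q) ->
  derivable f p (evec i) -> derivable g p (evec i).
Proof.
move=> oU Up fg; apply: near_eq_derivable.
have Un : \forall q \near p, U q by exact: open_nbhs_nbhs.
by apply: filterS Un => q; exact: fg.
Qed.

Lemma dirderiv_eq_on U f g p x : open U -> U p -> (forall q, U q -> f q = g q) ->
  dirderiv f p x = dirderiv g p x.
Proof.
by move=> oU Up fg; apply: eq_bigr => i _; rewrite (partial_eq_on i oU Up fg).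
Qed.

(** Existence of all partials is bundled with the value, so that the rules below compose into proof
    terms shaped like the differentiated expression. *)
Definition has_dirderiv f p x (a : R) : Prop :=
  (forall i, derivable f p (evec i)) /\ dirderiv f p x = a.

Lemma has_dirderivI f p x : (forall i, derivable f p (evec i)) ->
  has_dirderiv f p x (dirderiv f p x).
Proof. by []. Qed.

Lemma has_dirderiv_is_derive f p x (a : 'I_N -> R) :
  (forall i, is_derive p (evec i) f (a i)) -> has_dirderiv f p x (\sum_i a i * x i 0).
Proof.
move=> H; split=> [i|]; first by case: (H i).
by apply: eq_bigr => i _; rewrite /partial; have [_ ->] := H i.
Qed.

Lemma has_dirderiv_add f g p x a b : has_dirderiv f p x a -> has_dirderiv g p x b ->
  has_dirderiv (fun q => f q + g q) p x (a + b).
Proof.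
move=> [df <-] [dg <-].
have [dfg E] := has_dirderiv_is_derive x
  (fun i => is_derive_add (derivableP (df i)) (derivableP (dg i))).
by split=> //; apply: etrans E _; rewrite -big_split; apply: eq_bigr => i _; rewrite mulrDl.
Qed.

Lemma has_dirderiv_mul f g p x a b : has_dirderiv f p x a -> has_dirderiv g p x b ->
  has_dirderiv (fun q => f q * g q) p x (a * g p + f p * b).
Proof.
move=> [df <-] [dg <-].
have [dfg E] := has_dirderiv_is_derive x
  (fun i => is_derive_mul (derivableP (df i)) (derivableP (dg i))).
split=> //; apply: etrans E _; rewrite /dirderiv mulr_suml mulr_sumr -big_split.
apply: eq_bigr => i _; rewrite mulrDl.
by apply: f_equal2; [exact: mulrAC|exact: esym (mulrA _ _ _)].
Qed.

Lemma has_dirderiv_opp f p x a : has_dirderiv f p x a ->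
  has_dirderiv (fun q => - f q) p x (- a).
Proof.
move=> [df <-]; split=> [i|]; first exact: derivableN.
rewrite /dirderiv -sumrN; apply: eq_bigr => i _.
by rewrite /partial -mulNr; congr (_ * _); exact: deriveN.
Qed.

Lemma has_dirderiv_inv f p x a : f p != 0 -> has_dirderiv f p x a ->
  has_dirderiv (fun q => (f q)^-1) p x (- (f p) ^- 2 * a).
Proof.
move=> f0 [df <-].
have [dfg E] := has_dirderiv_is_derive x (fun i => is_derive_inv f0 (derivableP (df i))).
split=> //; apply: etrans E _; rewrite /dirderiv mulr_sumr.
by apply: eq_bigr => i _; rewrite mulrA.
Qed.

Lemma has_dirderiv_sum (I : finType) (f : I -> 'cV[R]_N -> R) p x (a : I -> R) :
  (forall k, has_dirderiv (f k) p x (a k)) ->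
  has_dirderiv (fun q => \sum_k f k q) p x (\sum_k a k).
Proof.
move=> H.
have [dfg E] := has_dirderiv_is_derive x
  (fun i => is_derive_bigsum (fun k => derivableP ((H k).1 i))).
split=> //; apply: etrans E _; under eq_bigr do rewrite mulr_suml.
by rewrite exchange_big; apply: eq_bigr => k _; rewrite -(H k).2.
Qed.

Lemma has_dirderiv_eq_on U f g p x a : open U -> U p -> (forall q, U q -> f q = g q) ->
  has_dirderiv g p x a -> has_dirderiv f p x a.
Proof.
move=> oU Up fg [dg <-]; split=> [i|]; last exact: dirderiv_eq_on fg.
by apply: derivable_eq_on oU Up _ (dg i) => q /fg.
Qed.

Lemma lie_bracketE X Y p k : lie_bracket X Y p k 0
  = dirderiv (fun q => Y q k 0) p (X p) - dirderiv (fun q => X q k 0) p (Y p).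
Proof.
rewrite mxE /dirderiv -sumrB; apply: eq_bigr => i _.
by rewrite mulrC [X in _ - X]mulrC.
Qed.

Lemma has_dirderiv_dirderiv U f p x Y : open U -> U p -> Ck_on U 2 f ->
  (forall i j, derivable (fun q => Y q j 0) p (evec i)) ->
  has_dirderiv (fun q => dirderiv f q (Y q)) p x
    (\sum_j (dirderiv (partial j f) p x * Y p j 0
             + partial j f p * dirderiv (fun q => Y q j 0) p x)).
Proof.
move=> oU Up f2 dY; apply: has_dirderiv_sum => j.
apply: (has_dirderiv_mul (f := partial j f) (g := fun q => Y q j 0)).
  by apply: has_dirderivI => i; exact: (((f2.2 j).2.2 i).1 p Up).
by apply: has_dirderivI => i; exact: dY.
Qed.

(** By the Leibniz rule both iterated derivatives split into a second-order and a first-order part.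
    The second-order parts agree by [partialC]; the first-order parts differ by the components of
    the bracket. *)
Lemma dirderiv_commutator U f p X Y : open U -> U p -> Ck_on U 2 f ->
  (forall i j, derivable (fun q => X q j 0) p (evec i)) ->
  (forall i j, derivable (fun q => Y q j 0) p (evec i)) ->
  dirderiv f p (lie_bracket X Y p) =
  dirderiv (fun q => dirderiv f q (Y q)) p (X p)
  - dirderiv (fun q => dirderiv f q (X q)) p (Y p).
Proof.
move=> oU Up f2 dX dY.
rewrite (has_dirderiv_dirderiv _ oU Up f2 dY).2 (has_dirderiv_dirderiv _ oU Up f2 dX).2.
rewrite !big_split /=.
have -> : \sum_j dirderiv (partial j f) p (X p) * Y p j 0
        = \sum_j dirderiv (partial j f) p (Y p) * X p j 0.
  rewrite /dirderiv; under eq_bigr do rewrite mulr_suml.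
  under [RHS]eq_bigr do rewrite mulr_suml.
  rewrite [RHS]exchange_big; apply: eq_bigr => i _; apply: eq_bigr => j _.
  by rewrite (partialC i j oU Up f2) mulrAC.
rewrite opprD addrACA subrr add0r -sumrB /dirderiv; apply: eq_bigr => k _.
by rewrite lie_bracketE mulrBr.
Qed.

End DirectionalDerivatives.

(** * Invariance of Vtilde under the connection, and the hyperplane orthogonal to d_v *)

Section ParallelAndCurvature.
Context {R : realType} {m : nat}.
Variable F : 'cV[R]_(2 + m) -> R.
Hypothesis F_smooth : smooth_on setT F.
Implicit Types (p q v w x z : 'cV[R]_(adim m)) (i j k l : 'I_(adim m)).
Implicit Types (X Y Z : 'cV[R]_(adim m) -> 'cV[R]_(adim m)).
Local Notation N := (adim m).
Local Notation g := (ambient_metric F).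
Local Notation M := (@ambient_space R m).

Lemma ambient_space_open : open M.
Proof.
rewrite openE => p Mp; apply: (cV_near (e := p i_t 0) Mp) => q qp.
have := le_lt_trans (normr_coord_le (p - q) i_t) qp; rewrite !mxE ltr_norml => /andP[_].
by rewrite ltrBlDr -ltrBlDl subrr.
Qed.

Lemma covderivE X Y p k : M p -> covderiv g X Y p k 0
  = dirderiv (fun q => Y q k 0) p (X p) + christoffel_form F p (X p) (Y p) k 0.
Proof.
move=> Mp; rewrite -(christoffelE (F_smooth 1)) // mxE /dirderiv -big_split.
apply: eq_bigr => i _; rewrite mulrDr mulrC mulr_sumr; congr (_ + _).
by apply: eq_bigr => j _; rewrite mulrCA mulrA.
Qed.

Lemma dist_VtildeP p w :
  dist_Vtilde p w <-> [/\ forall A, w (i_x A) 0 = 0, w i_u 0 = 0 & w i_t 0 = 0].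
Proof.
split=> [[a [b ->]]|[wx wu wt]].
  by split=> [A||]; rewrite !mxE !adim_eqE !mulr0 addr0.
exists (w i_v 0), (w i_rho 0); apply/matrixP => k l; rewrite ord1 !mxE eqxx !andbT.
by move: k; apply: adim_ind => [||A||]; rewrite !adim_eqE ?wx ?wu ?wt;
  rewrite ?mulr0 ?mulr1 ?addr0 ?add0r.
Qed.

Lemma dirderiv_zero_on f p x : M p -> (forall q, M q -> f q = 0) -> dirderiv f p x = 0.
Proof.
move=> Mp f0; rewrite (dirderiv_eq_on x ambient_space_open Mp (g := cst 0) f0).
by rewrite /dirderiv big1 // => i _; rewrite /partial derive_cst mul0r.
Qed.

(** In the rows x^A, u and t of Gamma(X, Y) every term has a factor Y_A, Y_u or Y_t. These vanish on
    the open set [M], and so do their derivatives there. *)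
Lemma Vtilde_connection_invariant : connection_invariant g M dist_Vtilde.
Proof.
move=> X Y _ _ YV p Mp; apply/dist_VtildeP.
have Yx A q : M q -> Y q (i_x A) 0 = 0 by move=> /YV/dist_VtildeP[].
have Yu q : M q -> Y q i_u 0 = 0 by move=> /YV/dist_VtildeP[].
have Yt q : M q -> Y q i_t 0 = 0 by move=> /YV/dist_VtildeP[].
split=> [A||]; rewrite covderivE // christoffel_formE ?Yu ?Yt ?Yx //.
- by rewrite (dirderiv_zero_on _ Mp (Yx A)) !(mulr0, mul0r, addr0, subr0, oppr0).
- by rewrite (dirderiv_zero_on _ Mp Yu) !(mulr0, mul0r, addr0, subr0, oppr0).
- by rewrite (dirderiv_zero_on _ Mp Yt) !(mulr0, mul0r, addr0, subr0, oppr0).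
Qed.

Lemma dist_hyperplaneP p w : dist_hyperplane p w <-> w i_u 0 = 0.
Proof.
split=> [[a [b [c [y ->]]]]|wu].
  rewrite !mxE summxE big1 => [|A _]; rewrite ?mxE ?adim_eqE ?mulr0 //.
  by rewrite !addr0.
exists (w i_v 0), (w i_rho 0), (w i_t 0), (fun A => w (i_x A) 0).
apply/matrixP => k l; rewrite ord1 !mxE summxE !eqxx !andbT.
have S0 i : (forall A, i == i_x A = false) ->
    \sum_A (w (i_x A) 0 *: (evec (i_x A) : 'cV[R]_N)) i 0 = 0.
  by move=> H; rewrite big1 // => A _; rewrite !mxE H mulr0.
have Sx B : \sum_A (w (i_x A) 0 *: (evec (i_x A) : 'cV[R]_N)) (i_x B) 0 = w (i_x B) 0.
  rewrite -(sum_delta B (fun A => w (i_x A) 0)).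
  by apply: eq_bigr => A _; rewrite !mxE adim_eqE eqxx andbT mulrC.
by move: k; apply: adim_ind => [||A||];
  rewrite ?Sx ?(S0 i_v) ?(S0 i_rho) ?(S0 i_u) ?(S0 i_t) ?adim_eqE ?wu;
  rewrite ?mulr0 ?mulr1 ?addr0 ?add0r // => A; rewrite adim_eqE.
Qed.

Lemma inner_evec_v p w : inner g p (evec i_v) w = p i_t 0 ^+ 2 * w i_u 0.
Proof.
rewrite innerE !mxE !adim_eqE big1 => [|A _]; last by rewrite !mxE adim_eqE mul0r.
by move: (F _) => Fp; rewrite eqxx /=; ring.
Qed.

Lemma orth_dist_V p : M p -> orth g dist_V p = dist_hyperplane p.
Proof.
move=> Mp; have t0 : p i_t 0 != 0 by apply: lt0r_neq0.
apply/seteqP; split=> w; last first.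
  move=> /dist_hyperplaneP wu v [a ->].
  rewrite /inner linearZ /= -!scalemxAl mxE.
  by have := inner_evec_v p w; rewrite /inner => ->; rewrite wu !mulr0.
move=> /(_ (evec i_v)) H; apply/dist_hyperplaneP.
have : inner g p (evec i_v) w = 0 by apply: H; exists 1; rewrite scale1r.
rewrite inner_evec_v => /eqP; rewrite mulf_eq0 expf_eq0 /= (negbTE t0) /=.
by move/eqP.
Qed.

End ParallelAndCurvature.

(** Turning derivatives and sums into variables leaves [field] with a plain rational identity. *)
Ltac generalize_dirderivs := repeat match goal with
  |- context [dirderiv ?f ?p ?x] => generalize (dirderiv f p x); intro end.
Ltac generalize_partials := repeat match goal with
  |- context [partial ?i ?f ?p] => generalize (partial i f p); intro end.
Ltac generalize_sums := repeat match goal with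
  |- context [\sum_A ?f] => generalize (\sum_A f); intro
  end.

Section Curvature.
Context {R : realType} {m : nat}.
Variable F : 'cV[R]_(2 + m) -> R.
Hypothesis F_smooth : smooth_on setT F.
Implicit Types (p q v w x z : 'cV[R]_(adim m)) (i j k l : 'I_(adim m)).
Implicit Types (X Y Z V : 'cV[R]_(adim m) -> 'cV[R]_(adim m)).
Local Notation N := (adim m).
Local Notation G := (fun p => F (F_args p)).
Local Notation g := (ambient_metric F).
Local Notation M := (@ambient_space R m).
Local Notation comp X k := (fun q => X q k 0).
Local Notation D X f := (fun q => dirderiv f q (X q)).

(** For V_u = 0 the partials of F survive only in the combination D_V G, and F itself disappears.
    The right sides are written with [+ -] and [^-1] so as to match the rules for [has_dirderiv]
    when they are differentiated again. *)
Lemma covderiv_hyperplaneE V Z : (forall q, M q -> V q i_u 0 = 0) ->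
  ((forall q, M q -> covderiv g V Z q i_v 0 = (D V (comp Z i_v) q
      + (Z q i_t 0 * V q i_v 0 + V q i_t 0 * Z q i_v 0) * (Defs.coord i_t q)^-1
      + Z q i_u 0 * D V G q)%R)
  * (forall q, M q -> covderiv g V Z q i_rho 0 = (D V (comp Z i_rho) q
      + (Z q i_t 0 * V q i_rho 0 + V q i_t 0 * Z q i_rho 0) * (Defs.coord i_t q)^-1
      + - (V q i_v 0 * Z q i_u 0 + \sum_A V q (i_x A) 0 * Z q (i_x A) 0))%R)
  * (forall A q, M q -> covderiv g V Z q (i_x A) 0 = (D V (comp Z (i_x A)) q
      + (Z q i_t 0 * V q (i_x A) 0 + V q i_t 0 * Z q (i_x A) 0) * (Defs.coord i_t q)^-1)%R)
  * (forall q, M q -> covderiv g V Z q i_u 0 = (D V (comp Z i_u) q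
      + V q i_t 0 * Z q i_u 0 * (Defs.coord i_t q)^-1)%R)
  * (forall q, M q -> covderiv g V Z q i_t 0 = D V (comp Z i_t) q))%type.
Proof.
move=> Vu; do !split=> *; rewrite covderivE // christoffel_formE Vu // /Defs.coord;
  by rewrite !(mul0r, mulr0, addr0, add0r, subr0, oppr0) ?addrA.
Qed.

Section SecondDerivatives.
Variables (p : 'cV[R]_N) (V Z : 'cV[R]_N -> 'cV[R]_N) (x : 'cV[R]_N).
Hypotheses (Mp : M p) (V_smooth : smooth_vfield_on M V) (Z_smooth : smooth_vfield_on M Z).
Hypothesis Vu : forall q, M q -> V q i_u 0 = 0.
Local Notation d f := (dirderiv f p x).
Local Notation t := (p i_t 0).
Local Notation z k := (Z p k 0).
Local Notation v k := (V p k 0).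

Lemma vfield_derivable Y k i : smooth_vfield_on M Y -> derivable (comp Y k) p (evec i).
Proof. by move=> /(_ k 1)/= [_ /(_ i)[/(_ p Mp)]]. Qed.

Let dZ k : has_dirderiv (comp Z k) p x (d (comp Z k)).
Proof. by apply: has_dirderivI => i; exact: vfield_derivable. Qed.

Let dV k : has_dirderiv (comp V k) p x (d (comp V k)).
Proof. by apply: has_dirderivI => i; exact: vfield_derivable. Qed.

Let dDZ k : has_dirderiv (D V (comp Z k)) p x (d (D V (comp Z k))).
Proof.
apply: has_dirderivI; apply: (has_dirderiv_dirderiv x ambient_space_open Mp (Z_smooth k 2) _).1.
by move=> i j; exact: vfield_derivable.
Qed.

Let dDG : has_dirderiv (D V G) p x (d (D V G)).
Proof.
apply: has_dirderivI.
apply: (has_dirderiv_dirderiv x openT (I : setT p) (Ck_on_F_args (F_smooth 2)) _).1.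
by move=> i j; exact: vfield_derivable.
Qed.

Let dt : has_dirderiv (fun q => (Defs.coord i_t q)^-1) p x (- t ^- 2 * x i_t 0).
Proof.
rewrite -(dirderiv_coord p x i_t); apply: has_dirderiv_inv; first exact: lt0r_neq0.
by apply: has_dirderivI => i; case: (is_derive_coord p (evec i) (@i_t m)).
Qed.

Lemma dirderiv_covderivE :
  ((d (comp (covderiv g V Z) i_v) = (d (D V (comp Z i_v))
     + ((d (comp Z i_t) * v i_v + z i_t * d (comp V i_v)
         + (d (comp V i_t) * z i_v + v i_t * d (comp Z i_v)))
        * t^-1 + (z i_t * v i_v + v i_t * z i_v) * (- t ^- 2 * x i_t 0))
     + (d (comp Z i_u) * D V G p + z i_u * d (D V G)))%R)
  * (d (comp (covderiv g V Z) i_rho) = (d (D V (comp Z i_rho))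
     + ((d (comp Z i_t) * v i_rho + z i_t * d (comp V i_rho)
         + (d (comp V i_t) * z i_rho + v i_t * d (comp Z i_rho)))
        * t^-1 + (z i_t * v i_rho + v i_t * z i_rho) * (- t ^- 2 * x i_t 0))
     + - (d (comp V i_v) * z i_u + v i_v * d (comp Z i_u)
          + \sum_A (d (comp V (i_x A)) * z (i_x A) + v (i_x A) * d (comp Z (i_x A)))))%R)
  * (forall A, d (comp (covderiv g V Z) (i_x A)) = (d (D V (comp Z (i_x A)))
     + ((d (comp Z i_t) * v (i_x A) + z i_t * d (comp V (i_x A))
         + (d (comp V i_t) * z (i_x A) + v i_t * d (comp Z (i_x A))))
        * t^-1 + (z i_t * v (i_x A) + v i_t * z (i_x A)) * (- t ^- 2 * x i_t 0)))%R)
  * (d (comp (covderiv g V Z) i_u) = (d (D V (comp Z i_u))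
     + ((d (comp V i_t) * z i_u + v i_t * d (comp Z i_u)) * t^-1
        + v i_t * z i_u * (- t ^- 2 * x i_t 0)))%R)
  * (d (comp (covderiv g V Z) i_t) = d (D V (comp Z i_t))))%type.
Proof.
have E f h a : (forall q, M q -> f q = h q) -> has_dirderiv h p x a -> d f = a.
  by move=> fh /(has_dirderiv_eq_on ambient_space_open Mp fh)[].
pose W := covderiv_hyperplaneE Z Vu.
do !split; [apply: (E _ _ _ W.1.1.1.1) | apply: (E _ _ _ W.1.1.1.2)
  | move=> A; apply: (E _ _ _ (W.1.1.2 A)) | apply: (E _ _ _ W.1.2)
  | exact: (E _ _ _ W.2 (dDZ i_t))].
- exact: (has_dirderiv_add (has_dirderiv_add (dDZ i_v) (has_dirderiv_mul
    (has_dirderiv_add (has_dirderiv_mul (dZ i_t) (dV i_v))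
      (has_dirderiv_mul (dV i_t) (dZ i_v))) dt))
    (has_dirderiv_mul (dZ i_u) dDG)).
- exact: (has_dirderiv_add (has_dirderiv_add (dDZ i_rho) (has_dirderiv_mul
    (has_dirderiv_add (has_dirderiv_mul (dZ i_t) (dV i_rho))
      (has_dirderiv_mul (dV i_t) (dZ i_rho))) dt))
    (has_dirderiv_opp (has_dirderiv_add (has_dirderiv_mul (dV i_v) (dZ i_u))
      (has_dirderiv_sum (fun A => has_dirderiv_mul (dV (i_x A)) (dZ (i_x A))))))).
- exact: (has_dirderiv_add (dDZ (i_x A)) (has_dirderiv_mul
    (has_dirderiv_add (has_dirderiv_mul (dZ i_t) (dV (i_x A)))
      (has_dirderiv_mul (dV i_t) (dZ (i_x A)))) dt)).
- exact: (has_dirderiv_add (dDZ i_u)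
    (has_dirderiv_mul (has_dirderiv_mul (dV i_t) (dZ i_u)) dt)).
Qed.

End SecondDerivatives.

Lemma curvature_hyperplane X Y Z p :
  smooth_vfield_on M X -> smooth_vfield_on M Y -> smooth_vfield_on M Z ->
  (forall q, M q -> X q i_u 0 = 0) -> (forall q, M q -> Y q i_u 0 = 0) ->
  M p -> curvature g X Y Z p = 0.
Proof.
move=> sX sY sZ Xu Yu Mp; have t0 : p i_t 0 != 0 by apply: lt0r_neq0.
have dXd i j : derivable (comp X j) p (evec i) by exact: (vfield_derivable Mp).
have dYd i j : derivable (comp Y j) p (evec i) by exact: (vfield_derivable Mp).
have CZ k := dirderiv_commutator ambient_space_open Mp (sZ k 2) dXd dYd.
have CG := dirderiv_commutator openT (I : setT p) (Ck_on_F_args (F_smooth 2)) dXd dYd.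
(* The hyperplane distribution is involutive, so the terms with a factor u-component also drop out
   of the bracket term of the curvature. *)
have Bu : lie_bracket X Y p i_u 0 = 0.
  by rewrite lie_bracketE (dirderiv_zero_on _ Mp Xu) (dirderiv_zero_on _ Mp Yu) subrr.
have addE (a b c : 'cV[R]_N) k : (a - b - c) k 0 = a k 0 - b k 0 - c k 0 by rewrite !mxE.
apply/matrixP => k l; rewrite ord1 [RHS]mxE /curvature addE.
rewrite !(covderivE F_smooth) //.
pose XYE := dirderiv_covderivE (X p) Mp sY sZ Yu.
pose YXE := dirderiv_covderivE (Y p) Mp sX sZ Xu.
pose WX := covderiv_hyperplaneE Z Xu.
pose WY := covderiv_hyperplaneE Z Yu.
move: k; apply: adim_ind => [||A||];
  rewrite !XYE !YXE !christoffel_formE Bu !Xu // !Yu // ?WX // ?WY // ?lie_bracketE !CZ ?CG.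
all: rewrite /Defs.coord.
- generalize_dirderivs; generalize_partials; try move: (F _) => ?; field; exact: t0.
(* In the rho row covariant derivatives stand under sums over A. They are expanded into common
   contractions, with the sum of X_A Y_A always in the same order, so that [field] can cancel whole
   sums as atoms. *)
- have sumE (a b c e : 'I_m -> R) (r1 r2 s : R) :
      \sum_A a A * (b A + (r1 * c A + r2 * e A) * s)
      = \sum_A a A * b A + r1 * s * (\sum_A a A * c A) + r2 * s * (\sum_A a A * e A).
    by rewrite !mulr_sumr -!big_split; apply: eq_bigr => A _ /=; ring.
  have -> : \sum_A X p (i_x A) 0 * covderiv g Y Z p (i_x A) 0 =
      \sum_A X p (i_x A) 0 * D Y (comp Z (i_x A)) p
      + Z p i_t 0 * (p i_t 0)^-1 * (\sum_A X p (i_x A) 0 * Y p (i_x A) 0)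
      + Y p i_t 0 * (p i_t 0)^-1 * (\sum_A X p (i_x A) 0 * Z p (i_x A) 0).
    by rewrite -sumE; apply: eq_bigr => A _; rewrite WY.
  have -> : \sum_A Y p (i_x A) 0 * covderiv g X Z p (i_x A) 0 =
      \sum_A Y p (i_x A) 0 * D X (comp Z (i_x A)) p
      + Z p i_t 0 * (p i_t 0)^-1 * (\sum_A X p (i_x A) 0 * Y p (i_x A) 0)
      + X p i_t 0 * (p i_t 0)^-1 * (\sum_A Y p (i_x A) 0 * Z p (i_x A) 0).
    under [X in _ + _ * X + _]eq_bigr do rewrite mulrC.
    by rewrite -sumE; apply: eq_bigr => A _; rewrite WX.
  have -> : \sum_A lie_bracket X Y p (i_x A) 0 * Z p (i_x A) 0 =
      \sum_A dirderiv (comp Y (i_x A)) p (X p) * Z p (i_x A) 0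
      - \sum_A dirderiv (comp X (i_x A)) p (Y p) * Z p (i_x A) 0.
    by rewrite -sumrB; apply: eq_bigr => A _; rewrite lie_bracketE mulrBl.
  rewrite !big_split /=.
  generalize_sums; generalize_dirderivs; generalize_partials.
  try move: (F _) => ?; field; exact: t0.
- generalize_dirderivs; generalize_partials; try move: (F _) => ?; field; exact: t0.
- generalize_dirderivs; generalize_partials; try move: (F _) => ?; field; exact: t0.
- generalize_dirderivs; generalize_partials; field; exact: t0.
Qed.

End Curvature.

(** * Parallel transport and holonomy *)

Section WithinContinuity.
Context {R : realType}.
Implicit Types (A : set R) (f g : R -> R).

Lemma within_continuous_add A f g : {within A, continuous f} -> {within A, continuous g} ->
  {within A, continuous (fun s => f s + g s)}.
Proof. by move=> cf cg x; apply: cvgD; [exact: cf|exact: cg]. Qed.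

Lemma within_continuous_mul A f g : {within A, continuous f} -> {within A, continuous g} ->
  {within A, continuous (fun s => f s * g s)}.
Proof. by move=> cf cg x; apply: cvgM; [exact: cf|exact: cg]. Qed.

Lemma within_continuous_opp A f : {within A, continuous f} ->
  {within A, continuous (fun s => - f s)}.
Proof. by move=> cf x; apply: cvgN; exact: cf. Qed.

Lemma within_continuous_const A (a : R) : {within A, continuous (fun=> a)}.
Proof. by move=> x; exact: cvg_cst. Qed.

Lemma within_continuous_sum A (I : finType) (f : I -> R -> R) :
  (forall i, {within A, continuous (f i)}) ->
  {within A, continuous (fun s => \sum_i f i s)}.
Proof.
by move=> cf x; apply: cvg_big => [|i _]; [exact: add_continuous|exact: cf].
Qed.

Lemma within_continuous_derivable A f : (forall s : R, derivable f s 1) ->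
  {within A, continuous f}.
Proof.
move=> df; apply: continuous_subspaceT => s.
exact/differentiable_continuous/derivable1_diffP.
Qed.

(** The hypotheses mirror [parallel_along], which gives a derivative only on the open interval;
    one-sided continuity carries the conclusion to the end points. *)
Lemma constant_on_unit_interval f : {within `[0, 1], continuous f} ->
  (forall s : R, 0 < s < 1 -> is_derive s 1 f 0) -> forall s, 0 <= s <= 1 -> f s = f 0.
Proof.
move=> cf df s /andP[s0 s1]; apply/eqP; rewrite -subr_eq0.
have [|| r _ ->] := @MVT_segment R f (fun=> 0) 0 s s0.
- move=> r; rewrite in_itv /= => /andP[r0 rs]; apply: df.
  by rewrite r0 (lt_le_trans rs).
- apply: continuous_subspaceW cf => r /=; rewrite !in_itv /= => /andP[-> rs].
  exact: le_trans rs s1.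
by rewrite mul0r.
Qed.

End WithinContinuity.

(** * Conserved quantities of parallel fields *)

Section Transport.
Context {R : realType} {m : nat}.
Variable F : 'cV[R]_(2 + m) -> R.
Hypothesis F_C1 : Ck_on setT 1 F.
Implicit Types (p q v w x z : 'cV[R]_(adim m)) (i j k l : 'I_(adim m)).
Local Notation N := (adim m).
Local Notation G := (fun p => F (F_args p)).
Local Notation g := (ambient_metric F).
Local Notation M := (@ambient_space R m).

Lemma dirderiv_F_args p z : dirderiv G p z = partial i_rho G p * z i_rho 0
  + \sum_A partial (i_x A) G p * z (i_x A) 0 + partial i_u G p * z i_u 0.
Proof.
rewrite /dirderiv adim_big (partial_F_args0 F p (or_introl (erefl _))).
by rewrite (partial_F_args0 F p (or_intror (erefl _))) !mul0r add0r addr0.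
Qed.

Section Arc.
Variable c : R -> 'cV[R]_N.
Hypotheses (c_smooth : smooth_curve c) (cM : forall s : R, 0 <= s <= 1 -> M (c s)).
Implicit Types V W : R -> 'cV[R]_N.

Let dc (s : R) i : is_derive s 1 (fun r => c r i 0) (curve_deriv c s i 0).
Proof. by rewrite mxE derive1E; apply: derivableP; exact: (@c_smooth i 0 0%N s). Qed.

Let dG (s : R) : is_derive s 1 (fun r => F (F_args (c r))) (dirderiv G (c s) (curve_deriv c s)).
Proof. exact: (is_derive_along (Ck_on_F_args F_C1) (dc s)). Qed.

Let cc i : {within `[0, 1], continuous (fun s => c s i 0)}.
Proof. by apply: within_continuous_derivable => s; case: (dc s i). Qed.

Let cG : {within `[0, 1], continuous (fun s => F (F_args (c s)))}.
Proof. by apply: within_continuous_derivable => s; case: (dG s). Qed.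

Lemma parallel_derive V k (s : R) : parallel_along g c V -> 0 < s < 1 ->
  is_derive s 1 (fun r => V r k 0) (- christoffel_form F (c s) (curve_deriv c s) (V s) k 0).
Proof.
move=> pV s01; have [_ /(_ s s01)] := pV k.
rewrite christoffelE //; apply: cM; by case/andP: s01 => /ltW -> /ltW ->.
Qed.

Lemma parallel_inner V W (s : R) : parallel_along g c V -> parallel_along g c W ->
  0 <= s <= 1 -> inner g (c s) (V s) (W s) = inner g (c 0) (V 0) (W 0).
Proof.
move=> pV pW; have [cV cW] := (fun k => (pV k).1, fun k => (pW k).1).
have dV k (s' : R) s01 := @parallel_derive V k s' pV s01.
have dW k (s' : R) s01 := @parallel_derive W k s' pW s01.
(* The formula of [innerE] with t^2 spelled as a product: convertible to it, and of the exact shape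
   that the derivative rules produce. *)
pose f r := c r i_t 0 * (V r i_rho 0 * W r i_t 0 + V r i_t 0 * W r i_rho 0)
  + 2 * c r i_rho 0 * V r i_t 0 * W r i_t 0
  + c r i_t 0 * c r i_t 0 * (V r i_u 0 * W r i_v 0 + V r i_v 0 * W r i_u 0
      + \sum_A V r (i_x A) 0 * W r (i_x A) 0 + 2 * F (F_args (c r)) * V r i_u 0 * W r i_u 0).
suff H : forall s : R, 0 <= s <= 1 -> f s = f 0 by rewrite !innerE; exact: H.
apply: constant_on_unit_interval.
  have wA := @within_continuous_add R `[0, 1].
  have wM := @within_continuous_mul R `[0, 1].
  have w2 := @within_continuous_const R `[0, 1] 2.
  exact: (wA _ _ (wA _ _
    (wM _ _ (@cc i_t) (wA _ _ (wM _ _ (cV i_rho) (cW i_t)) (wM _ _ (cV i_t) (cW i_rho))))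
    (wM _ _ (wM _ _ (wM _ _ w2 (@cc i_rho)) (cV i_t)) (cW i_t)))
    (wM _ _ (wM _ _ (@cc i_t) (@cc i_t)) (wA _ _ (wA _ _ (wA _ _
      (wM _ _ (cV i_u) (cW i_v)) (wM _ _ (cV i_v) (cW i_u)))
      (within_continuous_sum (fun A => wM _ _ (cV (i_x A)) (cW (i_x A)))))
      (wM _ _ (wM _ _ (wM _ _ w2 (@cG)) (cV i_u)) (cW i_u))))).
move=> r r01; have tn0 : c r i_t 0 != 0.
  by apply/lt0r_neq0/cM; case/andP: r01 => /ltW -> /ltW ->.
have c2 := is_derive_const (2 : R) (r : R) (1 : R).
have := is_derive_add (is_derive_add
  (is_derive_mul (dc r i_t) (is_derive_add
     (is_derive_mul (dV i_rho r r01) (dW i_t r r01))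
     (is_derive_mul (dV i_t r r01) (dW i_rho r r01))))
  (is_derive_mul (is_derive_mul (is_derive_mul c2 (dc r i_rho)) (dV i_t r r01)) (dW i_t r r01)))
  (is_derive_mul (is_derive_mul (dc r i_t) (dc r i_t)) (is_derive_add (is_derive_add (is_derive_add
     (is_derive_mul (dV i_u r r01) (dW i_v r r01))
     (is_derive_mul (dV i_v r r01) (dW i_u r r01)))
     (is_derive_bigsum (fun A => is_derive_mul (dV (i_x A) r r01) (dW (i_x A) r r01))))
     (is_derive_mul (is_derive_mul (is_derive_mul c2 (dG r)) (dV i_u r r01)) (dW i_u r r01)))).
move/is_derive_eq; apply.
rewrite !christoffel_formE.
set x := curve_deriv c r; set p := c r.
rewrite (dirderiv_F_args p (V r)) (dirderiv_F_args p (W r)).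
(* Five contractions that [field] then treats as atoms. Those with partials of F cancel against the
   v row, those with the velocity x_A against the rho row, and the sum of V_A W_A against the
   derivative of t^2. *)
have -> : \sum_A (- christoffel_form F p x (V r) (i_x A) 0 * W r (i_x A) 0
     + V r (i_x A) 0 * - christoffel_form F p x (W r) (i_x A) 0)
   = - (V r i_t 0 / p i_t 0) * (\sum_A x (i_x A) 0 * W r (i_x A) 0)
     - (W r i_t 0 / p i_t 0) * (\sum_A x (i_x A) 0 * V r (i_x A) 0)
     - 2 * (x i_t 0 / p i_t 0) * (\sum_A V r (i_x A) 0 * W r (i_x A) 0)
     + x i_u 0 * V r i_u 0 * (\sum_A partial (i_x A) G p * W r (i_x A) 0)
     + x i_u 0 * W r i_u 0 * (\sum_A partial (i_x A) G p * V r (i_x A) 0).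
  rewrite !mulr_sumr -!sumrN -!big_split; apply: eq_bigr => A _ /=.
  by rewrite !christoffel_formE; generalize_partials; field; exact: tn0.
generalize_sums; generalize_dirderivs; generalize_partials; move: (F _) => Fp.
by field; exact: tn0.
Qed.

(* (t V_u, V_t) solves a linear system with a traceless matrix, so its Wronskian
   is constant. *)
Lemma parallel_wronskian V W (s : R) : parallel_along g c V -> parallel_along g c W ->
  0 <= s <= 1 -> c s i_t 0 * (V s i_u 0 * W s i_t 0 - V s i_t 0 * W s i_u 0)
  = c 0 i_t 0 * (V 0 i_u 0 * W 0 i_t 0 - V 0 i_t 0 * W 0 i_u 0).
Proof.
move=> pV pW; have [cV cW] := (fun k => (pV k).1, fun k => (pW k).1).
have dV k (s' : R) s01 := @parallel_derive V k s' pV s01.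
have dW k (s' : R) s01 := @parallel_derive W k s' pW s01.
pose f r := c r i_t 0 * (V r i_u 0 * W r i_t 0 + - (V r i_t 0 * W r i_u 0)).
suff H : forall s : R, 0 <= s <= 1 -> f s = f 0 by exact: H.
apply: constant_on_unit_interval.
  have wM := @within_continuous_mul R `[0, 1].
  exact: (wM _ _ (@cc i_t) (within_continuous_add (wM _ _ (cV i_u) (cW i_t))
    (within_continuous_opp (wM _ _ (cV i_t) (cW i_u))))).
move=> r r01; have tn0 : c r i_t 0 != 0.
  by apply/lt0r_neq0/cM; case/andP: r01 => /ltW -> /ltW ->.
have := is_derive_mul (dc r i_t) (is_derive_add
     (is_derive_mul (dV i_u r r01) (dW i_t r r01))
     (is_derive_opp (is_derive_mul (dV i_t r r01) (dW i_u r r01)))).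
move/is_derive_eq; apply.
rewrite !christoffel_formE.
set x := curve_deriv c r; set p := c r.
by generalize_partials; field; exact: tn0.
Qed.

(** When V_u = V_t = 0 the x^A row of the parallel equation is V_A' = - (t' / t) V_A. *)
Lemma parallel_x V A (s : R) : parallel_along g c V ->
  (forall r : R, 0 <= r <= 1 -> V r i_u 0 = 0 /\ V r i_t 0 = 0) ->
  0 <= s <= 1 -> c s i_t 0 * V s (i_x A) 0 = c 0 i_t 0 * V 0 (i_x A) 0.
Proof.
move=> pV V0; have cV k := (pV k).1.
have dV k (s' : R) s01 := @parallel_derive V k s' pV s01.
pose f r := c r i_t 0 * V r (i_x A) 0.
suff H : forall s : R, 0 <= s <= 1 -> f s = f 0 by exact: H.
apply: constant_on_unit_interval.
  exact: (within_continuous_mul (@cc i_t) (cV (i_x A))).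
move=> r r01; have r01' : 0 <= r <= 1 by case/andP: r01 => /ltW -> /ltW ->.
have tn0 : c r i_t 0 != 0 by apply/lt0r_neq0/cM.
have [Vu Vt] := V0 r r01'.
move: (is_derive_mul (dc r i_t) (dV (i_x A) r r01)) => /is_derive_eq; apply.
rewrite !christoffel_formE Vu Vt.
by generalize_partials; field; exact: tn0.
Qed.

End Arc.
End Transport.

(** * Identities satisfied by transports, and their linearisation *)

Section Holonomy.
Context {R : realType} {m : nat}.
Variable F : 'cV[R]_(2 + m) -> R.
Hypothesis F_C1 : Ck_on setT 1 F.
Implicit Types (p q v w x z : 'cV[R]_(adim m)) (i j k l : 'I_(adim m)).
Local Notation N := (adim m).
Local Notation g := (ambient_metric F).
Local Notation M := (@ambient_space R m).

(* The last clause says that the fields d_A / t are parallel modulo Vtilde inside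
   the orthogonal complement of Vtilde. *)
Definition transport_spec p q (P : 'M[R]_N) : Prop :=
  [/\ M p /\ M q,
      forall v w, inner g q (P *m v) (P *m w) = inner g p v w,
      forall v w, q i_t 0 * ((P *m v) i_u 0 * (P *m w) i_t 0 - (P *m v) i_t 0 * (P *m w) i_u 0)
        = p i_t 0 * (v i_u 0 * w i_t 0 - v i_t 0 * w i_u 0)
    & forall w, w i_u 0 = 0 -> w i_t 0 = 0 ->
        [/\ (P *m w) i_u 0 = 0, (P *m w) i_t 0 = 0
          & forall A, q i_t 0 * (P *m w) (i_x A) 0 = p i_t 0 * w (i_x A) 0]].

(** Every clause equates a quantity at the end point with the same quantity at the start, so the
    clauses chain; this covers piecewise smooth curves. *)
Lemma transport_spec_comp p q r P Q :
  transport_spec p q P -> transport_spec q r Q -> transport_spec p r (Q *m P).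
Proof.
move=> [[Mp Mq] Pi Pw Px] [[_ Mr] Qi Qw Qx]; split=> [|v w|v w|w wu wt].
- by split.
- by rewrite -!mulmxA Qi Pi.
- by rewrite -!mulmxA Qw Pw.
have [Pu Pt PA] := Px w wu wt; have [Qu Qt QA] := Qx _ Pu Pt.
by rewrite -!mulmxA; split=> // A; rewrite QA PA.
Qed.

Lemma inner_evec p i j : inner g p (evec i) (evec j) = g p i j.
Proof. by rewrite /inner trmx_delta -mulmxA -colE -rowE !mxE. Qed.

(* The metric makes a parallel frame nondegenerate at every time. *)
Lemma parallel_frame (c : R -> 'cV[R]_N) (V : 'I_N -> R -> 'cV[R]_N) (s : R) :
  smooth_curve c -> (forall s : R, 0 <= s <= 1 -> M (c s)) ->
  (forall i, parallel_along g c (V i)) -> (forall i, V i 0 = evec i) -> 0 <= s <= 1 ->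
  forall y : 'cV[R]_N, exists a : 'I_N -> R, forall k, \sum_i a i * V i s k 0 = y k 0.
Proof.
move=> cs cM pV V0 s01 y.
pose E : 'M[R]_N := \matrix_(k, i) V i s k 0.
have EV i : col i E = V i s by apply/matrixP => k l; rewrite ord1 !mxE.
have EE : E^T *m g (c s) *m E = g (c 0).
  apply/matrixP => i j; rewrite -inner_evec -(V0 i) -(V0 j).
  rewrite -(parallel_inner F_C1 cs cM (pV i) (pV j) s01) -!EV.
  rewrite /inner -!mulmxA mxE [RHS]mxE.
  by apply: eq_bigr => k _; rewrite !mxE; congr (_ * _); apply: eq_bigr => l _; rewrite !mxE.
have Eu : E \in unitmx.
  have : g (c 0) \in unitmx by apply: metric_unit; apply: cM; rewrite lexx ler01.
  by rewrite -EE unitmx_mul => /andP[].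
exists (fun i => (invmx E *m y) i 0) => k.
transitivity ((E *m (invmx E *m y)) k 0); last by rewrite mulKVmx.
by rewrite [RHS]mxE; apply: eq_bigr => i _; rewrite mulrC !mxE.
Qed.

Lemma transport_spec_arc (c : R -> 'cV[R]_N) (P : 'M[R]_N) :
  smooth_curve c -> (forall s : R, 0 <= s <= 1 -> M (c s)) ->
  (forall w, exists V : R -> 'cV[R]_N,
      [/\ parallel_along g c V, V 0 = w & V 1 = P *m w]) ->
  transport_spec (c 0) (c 1) P.
Proof.
move=> cs cM /choice[V VP].
have pV w : parallel_along g c (V w) by case: (VP w).
have V0 w : V w 0 = w by case: (VP w).
have V1 w : V w 1 = P *m w by case: (VP w).
have h1 : 0 <= (1 : R) <= 1 by rewrite ler01 lexx.
have h0 : 0 <= (0 : R) <= 1 by rewrite ler01 lexx.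
split=> [|v w|v w|w wu wt].
- by split; exact: cM.
- by rewrite -!V1 (parallel_inner F_C1 cs cM (pV v) (pV w) h1) !V0.
- by rewrite -!V1 (parallel_wronskian F_C1 cs cM (pV v) (pV w) h1) !V0.
have Z (r : R) : 0 <= r <= 1 -> V w r i_u 0 = 0 /\ V w r i_t 0 = 0.
  move=> r01; have tn0 : c r i_t 0 != 0 by apply/lt0r_neq0/cM.
  have W i : V w r i_u 0 * V (evec i) r i_t 0 - V w r i_t 0 * V (evec i) r i_u 0 = 0.
    apply: (mulfI tn0).
    rewrite (parallel_wronskian F_C1 cs cM (pV w) (pV (evec i)) r01).
    by rewrite V0 wu wt !mul0r subrr !mulr0.
  (* The Wronskian is linear in its second argument and vanishes on the parallel frame, hence on
     every [y]; the choices d_t and d_u isolate V_u and V_t. *)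
  have key (y : 'cV[R]_N) : V w r i_u 0 * y i_t 0 - V w r i_t 0 * y i_u 0 = 0.
    have [a aE] := @parallel_frame c (fun i => V (evec i)) r cs cM
      (fun i => pV (evec i)) (fun i => V0 (evec i)) r01 y.
    rewrite -!aE !mulr_sumr -sumrB big1 // => i _.
    by rewrite !(mulrCA _ (a i)) -mulrBr W mulr0.
  split.
    by have := key (evec i_t); rewrite !mxE !adim_eqE eqxx mulr0 subr0 mulr1.
  have := key (evec i_u); rewrite !mxE !adim_eqE eqxx mulr0 sub0r mulr1.
  by move/eqP; rewrite oppr_eq0 => /eqP.
have [Zu Zt] := Z 1 h1; rewrite -V1; split=> // A.
by rewrite (parallel_x F_C1 cs cM A (pV w) Z h1) V0.
Qed.

Lemma par_transport_spec p q P : par_transport g M p q P -> transport_spec p q P.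
Proof.
elim=> [c P' cs cM H|p' q' r P1 P2 _ H1 _ H2]; first exact: transport_spec_arc.
exact: transport_spec_comp H1 H2.
Qed.

Lemma Vtilde_transport_invariant : transport_invariant g M dist_Vtilde.
Proof.
move=> p q P /par_transport_spec[[Mp Mq] _ _ Px] w /dist_VtildeP[wx wu wt].
have [Pu Pt PA] := Px w wu wt; apply/dist_VtildeP; split=> // A.
by apply: (mulfI (lt0r_neq0 Mq)); rewrite PA wx !mulr0.
Qed.

(** The linearisation of [transport_spec] for loops. The conditions w_u = w_t = 0 describe
    Vtilde^perp, and the last clause is the trace on the quotient by Vtilde^perp. *)
Definition holonomy_constraints p (A : 'M[R]_N) : Prop :=
  [/\ A^T *m g p + g p *m A = 0,
      forall w, w i_u 0 = 0 -> w i_t 0 = 0 -> dist_Vtilde p (A *m w)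
    & A i_u i_u + A i_t i_t = 0].

(** Each clause of [transport_spec] makes some expression in the entries of [c s] independent of
    [s]; its derivative at [c 0 = 1] vanishes, which is the corresponding constraint. *)
Lemma holonomy_algebra_constraints p A :
  holonomy_algebra g M p A -> holonomy_constraints p A.
Proof.
move=> [c [cs c0 cP <-]].
have S s := par_transport_spec (cP s).
have Mp : M p by case: (S 0) => [[]].
have tn0 : p i_t 0 != 0 by exact: lt0r_neq0.
have dc i j : is_derive (0 : R) 1 (fun r => c r i j) (curve_deriv c 0 i j).
  by rewrite mxE derive1E; apply: derivableP; exact: (cs i j 0%N 0).
have dconst (f : R -> R) (a d : R) : (forall r, f r = a) -> is_derive (0 : R) 1 f d -> d = 0.
  move=> fa; have -> : f = cst a by apply/funext.
  by move=> [_ <-]; rewrite derive_cst.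
have cE (j : 'I_N) r k : (c r *m evec j) k 0 = c r k j by rewrite -colE mxE.
have c0E i j : c 0 i j = (i == j)%:R by rewrite c0 mxE.
(* Start and end of a loop share the same t, which cancels in the last clause of [transport_spec];
   these entries of [c r] are therefore constant in [r]. *)
have Z j : i_u != j -> i_t != j -> [/\ curve_deriv c 0 i_u j = 0, curve_deriv c 0 i_t j = 0
    & forall A, curve_deriv c 0 (i_x A) j = 0].
  move=> uj tj; have H r := let: And4 _ _ _ h := S r in h (evec j).
  have ej k : (evec j : 'cV[R]_N) k 0 = (k == j)%:R by rewrite mxE eqxx andbT.
  have H' r : [/\ c r i_u j = 0, c r i_t j = 0 & forall A, c r (i_x A) j = (i_x A == j)%:R].
    have [||h1 h2 h3] := H r; rewrite ?ej ?(negbTE uj) ?(negbTE tj) //.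
    rewrite -!cE; split=> [||B]; [exact: h1|exact: h2|apply: (mulfI tn0)]; by rewrite -cE h3 ej.
  split=> [||B].
  - by apply: (dconst _ 0 _ _ (dc i_u j)) => r; case: (H' r).
  - by apply: (dconst _ 0 _ _ (dc i_t j)) => r; case: (H' r).
  - by apply: (dconst _ (i_x B == j)%:R _ _ (dc (i_x B) j)) => r; case: (H' r).
split.
- apply/matrixP => i j; rewrite [LHS]mxE [X in X + _]mxE [X in _ + X]mxE [RHS]mxE.
  have E r : \sum_k c r k i * (\sum_l g p k l * c r l j) = g p i j.
    rewrite -(inner_evec p i j) -(let: And4 _ h _ _ := S r in h (evec i) (evec j)).
    rewrite /inner -mulmxA [RHS]mxE; apply: eq_bigr => k _.
    rewrite [X in _ = X * _]mxE cE; congr (_ * _); rewrite mxE.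
    by apply: eq_bigr => l _; rewrite cE.
  have D := dconst _ _ _ E (is_derive_bigsum (fun k => is_derive_mul (dc k i)
    (is_derive_bigsum (fun l =>
      is_derive_mul (is_derive_const (g p k l) (0 : R) (1 : R)) (dc l j))))).
  apply: etrans _ D; rewrite [RHS]big_split /=; congr (_ + _).
    apply: eq_bigr => k _; rewrite [_^T _ _]mxE; congr (_ * _).
    by under eq_bigr do rewrite c0E eq_sym; rewrite sum_deltar.
  transitivity (\sum_k (i == k)%:R * \sum_l g p k l * curve_deriv c 0 l j).
    by rewrite sum_delta.
  apply: eq_bigr => k _; rewrite c0E eq_sym; congr (_ * _).
  by apply: eq_bigr => l _; rewrite mul0r add0r.
- move=> w wu wt; apply/dist_VtildeP.
  have W k : (forall j, i_u != j -> i_t != j -> curve_deriv c 0 k j = 0) ->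
      (curve_deriv c 0 *m w) k 0 = 0.
    move=> H; rewrite mxE big1 // => j _.
    have [<-|uj] := eqVneq i_u j; first by rewrite wu mulr0.
    have [<-|tj] := eqVneq i_t j; first by rewrite wt mulr0.
    by rewrite H // mul0r.
  by split=> [B||]; apply: W => j uj tj; have [? ? ?] := Z j uj tj.
(* On d_u and d_t the Wronskian clause says that the (u, t) minor of [c r] equals 1, and the
   derivative of a determinant at the identity is the trace. *)
- have E r : c r i_u i_u * c r i_t i_t + - (c r i_t i_u * c r i_u i_t) = 1.
    have := let: And4 _ _ h _ := S r in h (evec i_u) (evec i_t).
    rewrite !cE !mxE !adim_eqE !eqxx /= => /(mulfI tn0) ->.
    by rewrite mulr1 mul0r subr0.
  have := dconst _ _ _ E (is_derive_add (is_derive_mul (dc i_u i_u) (dc i_t i_t))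
    (is_derive_opp (is_derive_mul (dc i_t i_u) (dc i_u i_t)))).
  by rewrite !c0E !adim_eqE !mulr1 !mul1r !mulr0 !mul0r addr0 oppr0 addr0.
Qed.

End Holonomy.

(** * The block form in an adapted basis *)

Section BlockForm.
Context {R : realType} {m : nat}.
Variable F : 'cV[R]_(2 + m) -> R.
Implicit Types (p q v w x z : 'cV[R]_(adim m)) (i j k l : 'I_(adim m)).
Local Notation N := (adim m).
Local Notation g := (ambient_metric F).
Local Notation M := (@ambient_space R m).

Lemma hol_block_entries (X : 'M[R]_2) (Z : 'M[R]_(2, m)) (a : R) :
  let M := block_mx X (row_mx Z (a *: Jmx))
                    0 (block_mx 0 (- Z^T) 0 (- X^T)) : 'M[R]_N in
  [/\ [/\ forall (k l : 'I_2), M (lshift (m + 2) k) (lshift (m + 2) l) = X k l,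
          forall (k : 'I_2) B, M (lshift (m + 2) k) (i_x B) = Z k B
        & forall (k l : 'I_2), M (lshift (m + 2) k) (rshift 2 (rshift m l)) = a * Jmx k l],
      [/\ forall B (l : 'I_2), M (i_x B) (lshift (m + 2) l) = 0,
          forall B C, M (i_x B) (i_x C) = 0
        & forall B (l : 'I_2), M (i_x B) (rshift 2 (rshift m l)) = - Z l B]
    & [/\ forall (k l : 'I_2), M (rshift 2 (rshift m k)) (lshift (m + 2) l) = 0,
          forall (k : 'I_2) C, M (rshift 2 (rshift m k)) (i_x C) = 0
        & forall (k l : 'I_2), M (rshift 2 (rshift m k)) (rshift 2 (rshift m l)) = - X l k]].
Proof.
rewrite /block_mx /i_x.
by do !split=> *; rewrite ?(col_mxEu, col_mxEd, row_mxEl, row_mxEr) ?mxE.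
Qed.

(** Skewness ties the columns u and t to the blocks [X] and [Z]. In the upper right corner it leaves
    a skew 2 by 2 block, which is a multiple of [Jmx]. *)
Lemma hol_block_algebraP (A : 'M[R]_N) :
  A^T *m block_metric + block_metric *m A = 0 ->
  (forall i, i_u != i -> i_t != i ->
     [/\ A i_u i = 0, A i_t i = 0 & forall B, A (i_x B) i = 0]) ->
  A i_v i_v + A i_rho i_rho = 0 -> hol_block_algebra A.
Proof.
move=> skew AZ tr.
have HE (w : 'cV[R]_N) : ((block_metric *m w) i_v 0 = w i_u 0)
    * ((block_metric *m w) i_rho 0 = w i_t 0)
    * (forall B, (block_metric *m w) (i_x B) 0 = w (i_x B) 0)
    * ((block_metric *m w) i_u 0 = w i_v 0) * ((block_metric *m w) i_t 0 = w i_rho 0).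
  by do !split=> *; rewrite mxE; under eq_bigr do rewrite block_metric_rowE;
    exact: (sum_delta _ (fun k => w k 0)).
(* Writing i' for the swap of v with u and of rho with t, skewness says that the entry (i', j) of
   [A] is minus the entry (j', i). *)
have S i j : (block_metric *m col j A) i 0 + (block_metric *m col i A) j 0 = 0.
  have Hsym : (block_metric : 'M[R]_N)^T = block_metric.
    apply/matrixP => k l; rewrite [LHS]mxE !block_metricE.
    under [in RHS]eq_bigr do rewrite mulrC.
    by move: (\sum_B _) => s; ring.
  move/matrixP/(_ i j): skew; rewrite [LHS]mxE [RHS]mxE addrC => <-.
  congr (_ + _); first by rewrite !mxE; apply: eq_bigr => k _; rewrite [col _ _ _ _]mxE.
  rewrite -{2}Hsym -trmx_mul !mxE.
  by apply: eq_bigr => k _; rewrite [col _ _ _ _]mxE.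
have cE k l : col l A k 0 = A k l by rewrite mxE.
exists (\matrix_(k, l) A (lshift (m + 2) k) (lshift (m + 2) l)),
  (\matrix_(k, B) A (lshift (m + 2) k) (i_x B)), (A i_v i_t).
split.
  rewrite /mxtrace big_ord_recl big_ord1 !mxE.
  by have -> : lift ord0 ord0 = 1 :> 'I_2 by exact: val_inj.
have [uv tv xv] := AZ i_v erefl erefl.
have [ur tr' xr] := AZ i_rho erefl erefl.
have AZx B : [/\ A i_u (i_x B) = 0, A i_t (i_x B) = 0 & forall C, A (i_x C) (i_x B) = 0].
  by apply: AZ; rewrite adim_eqE.
have N2 (a b : R) : a + b = 0 -> a = - b by move/eqP; rewrite addr_eq0 => /eqP.
have half (a : R) : a + a = 0 -> a = 0.
  by move/eqP; rewrite -mulr2n mulrn_eq0 => /eqP.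
set X := \matrix_(k, l) _; set Z := \matrix_(k, B) _; set a := A i_v i_t.
have [[E11 E1x E13] [Ex1 Exx Ex3] [E31 E3x E33]] := hol_block_entries X Z a.
have X00 : X 0 0 = A i_v i_v by rewrite mxE.
have X01 : X 0 1 = A i_v i_rho by rewrite mxE.
have X10 : X 1 0 = A i_rho i_v by rewrite mxE.
have X11 : X 1 1 = A i_rho i_rho by rewrite mxE.
have Z0 B : Z 0 B = A i_v (i_x B) by rewrite mxE.
have Z1 B : Z 1 B = A i_rho (i_x B) by rewrite mxE.
have [J00 J11] : Jmx 0 0 = 0 :> R /\ Jmx 1 1 = 0 :> R by rewrite !mxE /= !subrr.
have [J01 J10] : Jmx 0 1 = 1 :> R /\ Jmx 1 0 = -1 :> R by rewrite !mxE /= subr0 sub0r.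
apply/matrixP; apply: adim_ind => [||B||]; apply: adim_ind => [||C||].
- by rewrite [RHS](E11 0 0) X00.
- by rewrite [RHS](E11 0 1) X01.
- by rewrite [RHS](E1x 0 C) Z0.
- rewrite [RHS](E13 0 0) J00 mulr0; apply: half.
  by have := S i_u i_u; rewrite !HE !cE.
- by rewrite [RHS](E13 0 1) J01 mulr1.
- by rewrite [RHS](E11 1 0) X10.
- by rewrite [RHS](E11 1 1) X11.
- by rewrite [RHS](E1x 1 C) Z1.
- rewrite [RHS](E13 1 0) J10 mulrN1; apply: N2.
  by have := S i_t i_u; rewrite !HE !cE.
- rewrite [RHS](E13 1 1) J11 mulr0; apply: half.
  by have := S i_t i_t; rewrite !HE !cE.
- by rewrite [RHS](Ex1 B 0) xv.
- by rewrite [RHS](Ex1 B 1) xr.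
- by rewrite [RHS](Exx B C); case: (AZx C).
- rewrite [RHS](Ex3 B 0) Z0; apply: N2.
  by have := S (i_x B) i_u; rewrite !HE !cE.
- rewrite [RHS](Ex3 B 1) Z1; apply: N2.
  by have := S (i_x B) i_t; rewrite !HE !cE.
- by rewrite [RHS](E31 0 0) uv.
- by rewrite [RHS](E31 0 1) ur.
- by rewrite [RHS](E3x 0 C); case: (AZx C).
- rewrite [RHS](E33 0 0) X00; apply: N2.
  by have := S i_v i_u; rewrite !HE !cE.
- rewrite [RHS](E33 0 1) X10; apply: N2.
  by have := S i_v i_t; rewrite !HE !cE.
- by rewrite [RHS](E31 1 0) tv.
- by rewrite [RHS](E31 1 1) tr'.
- by rewrite [RHS](E3x 1 C); case: (AZx C).
- rewrite [RHS](E33 1 0) X01; apply: N2.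
  by have := S i_rho i_u; rewrite !HE !cE.
- rewrite [RHS](E33 1 1) X11; apply: N2.
  by have := S i_rho i_t; rewrite !HE !cE.
Qed.

Lemma inner_evec_rho p w : inner g p (evec i_rho) w = p i_t 0 * w i_t 0.
Proof.
rewrite innerE !mxE !adim_eqE big1 => [|A _]; last by rewrite !mxE adim_eqE mul0r.
by move: (F _) => Fp; rewrite eqxx /=; ring.
Qed.

Lemma skew_inner p (A : 'M[R]_N) v w : A^T *m g p + g p *m A = 0 ->
  inner g p (A *m v) w + inner g p v (A *m w) = 0.
Proof.
move=> skew; have : (v^T *m (A^T *m g p + g p *m A) *m w) 0 0 = 0.
  by rewrite skew mulmx0 mul0mx mxE.
by rewrite mulmxDr mulmxDl mxE /inner trmx_mul !mulmxA.
Qed.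

(** As g(d_v, .) = t^2 du and g(d_rho, .) = t dt, skewness on the pairs (d_v, d_u) and (d_rho, d_t)
    gives A_vv = - A_uu and A_rhorho = - A_tt; the right sides sum to zero. *)
Lemma holonomy_constraints_trace p (A : 'M[R]_N) : M p ->
  holonomy_constraints F p A -> A i_v i_v + A i_rho i_rho = 0.
Proof.
move=> Mp [skew AV tr]; have t0 : p i_t 0 != 0 by apply: lt0r_neq0.
have cE k l : (A *m evec l) k 0 = A k l by rewrite -colE mxE.
have [vx vu vt] : [/\ forall B, A (i_x B) i_v = 0, A i_u i_v = 0 & A i_t i_v = 0].
  have := AV (evec i_v); rewrite !mxE !adim_eqE => /(_ erefl erefl)/dist_VtildeP.
  by rewrite !cE => -[H ? ?]; split=> // B; have := H B; rewrite cE.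
have [rx ru rt] : [/\ forall B, A (i_x B) i_rho = 0, A i_u i_rho = 0 & A i_t i_rho = 0].
  have := AV (evec i_rho); rewrite !mxE !adim_eqE => /(_ erefl erefl)/dist_VtildeP.
  by rewrite !cE => -[H ? ?]; split=> // B; have := H B; rewrite cE.
have eE k l : (evec l : 'cV[R]_N) k 0 = (k == l)%:R by rewrite mxE eqxx andbT.
have Ev : A i_v i_v + A i_u i_u = 0.
  have := skew_inner (evec i_v) (evec i_u) skew.
  rewrite inner_evec_v innerE big1 => [|B _]; last by rewrite cE vx mul0r.
  rewrite !cE vu vt !eE !adim_eqE !(mulr0, mul0r, addr0, add0r, mulr1) -mulrDr.
  by move/eqP; rewrite mulf_eq0 expf_eq0 /= (negbTE t0) => /eqP.
have Er : A i_rho i_rho + A i_t i_t = 0.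
  have := skew_inner (evec i_rho) (evec i_t) skew.
  rewrite inner_evec_rho innerE big1 => [|B _]; last by rewrite cE rx mul0r.
  rewrite !cE ru rt !eE !adim_eqE !(mulr0, mul0r, addr0, add0r, mulr1) -mulrDr.
  by move/eqP; rewrite mulf_eq0 (negbTE t0) => /eqP.
have : A i_v i_v + A i_u i_u + (A i_rho i_rho + A i_t i_t) = 0 by rewrite Ev Er addr0.
by rewrite addrACA tr addr0.
Qed.

(** Every adapted basis respects the flag Vtilde, Vtilde^perp, so the vanishing entries persist;
    skewness is transported by congruence, and the trace on Vtilde is unchanged by conjugation
    there. *)
Lemma hol_block_conj p (A B : 'M[R]_N) : M p ->
  holonomy_constraints F p A -> adapted_basis g p B ->
  hol_block_algebra (invmx B *m A *m B).
Proof.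
move=> Mp HA [uB gB VB]; have trA := holonomy_constraints_trace Mp HA.
have t0 : p i_t 0 != 0 by apply: lt0r_neq0.
case: HA => skew AV _; set A' := invmx B *m A *m B.
have ABE : A *m B = B *m A' by rewrite /A' !mulmxA mulmxV // mul1mx.
have low (w : 'cV[R]_N) (k : 'I_(m + 2)) : dist_Vtilde p w -> w (rshift 2 k) 0 = 0.
  by move=> [a [b ->]]; rewrite !mxE !eq_shift !mulr0 addr0.
have Vcoord (w : 'cV[R]_N) : dist_Vtilde p w -> exists c : 'cV[R]_2, w = B *m col_mx c 0.
  move=> /VB[c ->]; exists c.
  by rewrite -{2}[B]hsubmxK mul_row_col mulmx0 addr0.
have inv_low (w : 'cV[R]_N) (k : 'I_(m + 2)) : dist_Vtilde p w -> (invmx B *m w) (rshift 2 k) 0 = 0.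
  by move=> /Vcoord[c ->]; rewrite mulKmx // col_mxEd mxE.
(* In the block metric the first two basis vectors pair only with the last two, so all other columns
   of [B] lie in Vtilde^perp. *)
have Borth (w : 'cV[R]_N) i : i_u != i -> i_t != i -> dist_Vtilde p w ->
    inner g p w (col i B) = 0.
  move=> ui ti /Vcoord[c ->]; rewrite colE /inner trmx_mul.
  have -> : (col_mx c 0)^T *m B^T *m g p *m (B *m delta_mx i 0)
          = (col_mx c 0)^T *m block_metric *m (delta_mx i 0 : 'cV[R]_N).
    by rewrite -gB !mulmxA.
  rewrite -mulmxA mxE adim_big.
  have cE k : (block_metric *m (delta_mx i 0 : 'cV[R]_N)) k 0 = (block_metric : 'M[R]_N) k i.
    by rewrite -colE [LHS]mxE.
  have cd (k : 'I_(m + 2)) : (col_mx c 0)^T 0 (rshift 2 k) = 0 by rewrite mxE col_mxEd mxE.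
  rewrite !cE !block_metric_rowE (negbTE ui) (negbTE ti) !mulr0.
  have cu := cd (rshift m 0); have ct := cd (rshift m 1).
  have cx C := cd (lshift 2 C); rewrite -/i_u -/i_t in cu ct.
  by rewrite cu ct big1 => [|C _]; rewrite ?cx ?mul0r ?addr0.
have Bcol i : i_u != i -> i_t != i -> B i_u i = 0 /\ B i_t i = 0.
  move=> ui ti; have Vv : dist_Vtilde p (evec i_v) by exists 1, 0; rewrite scale1r scale0r addr0.
  have Vr : dist_Vtilde p (evec i_rho) by exists 0, 1; rewrite scale1r scale0r add0r.
  have := Borth _ i ui ti Vv; have := Borth _ i ui ti Vr.
  rewrite inner_evec_v inner_evec_rho !mxE => /eqP; rewrite mulf_eq0 (negbTE t0) => /eqP ->.
  by move/eqP; rewrite mulf_eq0 expf_eq0 /= (negbTE t0) => /eqP ->.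
have A'low i (k : 'I_(m + 2)) : i_u != i -> i_t != i -> A' (rshift 2 k) i = 0.
  move=> ui ti; have [bu bt] := Bcol i ui ti.
  have -> : A' (rshift 2 k) i = (invmx B *m (A *m col i B)) (rshift 2 k) 0.
    by rewrite colE !mulmxA -colE [RHS]mxE.
  by apply: inv_low; apply: AV; rewrite mxE.
apply: hol_block_algebraP.
- rewrite -gB /A' !trmx_mul.
  have -> : B^T *m (A^T *m (invmx B)^T) *m (B^T *m g p *m B) = B^T *m (A^T *m g p) *m B.
    have tI : (invmx B)^T *m B^T = 1%:M by rewrite -trmx_mul mulmxV // trmx1.
    by rewrite !mulmxA -[_ *m (invmx B)^T *m B^T]mulmxA tI mulmx1.
  have -> : B^T *m g p *m B *m (invmx B *m A *m B) = B^T *m (g p *m A) *m B.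
    by rewrite !mulmxA -[_ *m B *m invmx B]mulmxA mulmxV // mulmx1.
  by rewrite -mulmxDl -mulmxDr skew mulmx0 mul0mx.
- by move=> i ui ti; split=> [||C]; exact: A'low.
(* The change of basis inside Vtilde, from d_v, d_rho to the first two columns of [B]; [A1] and [X]
   are the restriction of the endomorphism in the two bases. *)
pose C : 'M[R]_2 := \matrix_(k, l) B (lshift (m + 2) k) (lshift (m + 2) l).
pose A1 : 'M[R]_2 := \matrix_(k, l) A (lshift (m + 2) k) (lshift (m + 2) l).
pose X : 'M[R]_2 := \matrix_(k, l) A' (lshift (m + 2) k) (lshift (m + 2) l).
have trE (Y : 'M[R]_2) : \tr Y = Y 0 0 + Y 1 1.
  rewrite /mxtrace big_ord_recl big_ord1.
  by have -> : lift ord0 ord0 = 1 :> 'I_2 by exact: val_inj.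
have Blow (l : 'I_2) (k : 'I_(m + 2)) : B (rshift 2 k) (lshift (m + 2) l) = 0.
  have := low (col (lshift (m + 2) l) B) k; rewrite [col _ _ _ _]mxE; apply.
  apply/VB; exists (delta_mx l 0); rewrite -colE.
  by apply/matrixP => a b; rewrite !mxE.
have CX : A1 *m C = C *m X.
  apply/matrixP => k l; move/matrixP/(_ (lshift (m + 2) k) (lshift (m + 2) l)): ABE.
  rewrite mxE [RHS]mxE big_split_ord [X in _ = X]big_split_ord /=.
  rewrite [X in _ + X]big1 => [|j _]; last by rewrite Blow mulr0.
  rewrite [X in _ = _ + X]big1 => [|j _]; last by rewrite A'low ?mulr0 // eq_shift.
  rewrite !addr0 => E; rewrite mxE [RHS]mxE.
  transitivity (\sum_(i < 2) A (lshift (m + 2) k) (lshift (m + 2) i)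
      * B (lshift (m + 2) i) (lshift (m + 2) l)).
    by apply: eq_bigr => j _; rewrite !mxE.
  by rewrite E; apply: eq_bigr => j _; rewrite !mxE.
(* d_v and d_rho are combinations of the first two columns of [B], and the coefficients form a right
   inverse of [C]. *)
have uC : C \in unitmx.
  have /choice[d dE] : forall l : 'I_2, exists c : 'cV[R]_2,
      evec (lshift (m + 2) l) = lsubmx B *m c.
    move=> l; apply/VB.
    have [->|->] : l = 0 \/ l = 1 by case: l => -[|[|//]] h; [left|right]; exact: val_inj.
      by exists 1, 0; rewrite scale1r scale0r addr0.
    by exists 0, 1; rewrite scale1r scale0r add0r.
  suff /mulmx1_unit[] // : C *m (\matrix_(k, l) d l k 0) = 1%:M by [].
  apply/matrixP => k l; rewrite [RHS]mxE.
  have := congr1 (fun w : 'cV[R]_N => w (lshift (m + 2) k) 0) (dE l).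
  rewrite /= [LHS]mxE eq_shift eqxx andbT => ->; rewrite !mxE.
  by apply: eq_bigr => j _; rewrite !mxE.
have XE : X = invmx C *m (A1 *m C) by rewrite CX mulKmx.
have : \tr X = 0 by rewrite XE mxtrace_mulC -mulmxA mulmxV // mulmx1 trE !mxE.
by rewrite trE !mxE.
Qed.

End BlockForm.

(* MathComp-Analysis; n = 2 + m. *)
Theorem theorem2p3 (R : realType) (m : nat) (F : 'cV[R]_(2 + m) -> R)
    (F_smooth : smooth_on setT F) :
  let g := ambient_metric F in
  let M := ambient_space in
  [/\ (* (i) *)
      connection_invariant g M dist_Vtilde /\
      transport_invariant g M dist_Vtilde,
      (* (ii) *)
      [/\ forall p, M p -> inner g p (evec i_v) (evec i_v) = 0,
          forall p, M p -> orth g dist_V p = dist_hyperplane p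
        & forall U V Y : 'cV[R]_(adim m) -> 'cV[R]_(adim m),
            smooth_vfield_on M U -> smooth_vfield_on M V ->
            smooth_vfield_on M Y ->
            section_of M (orth g dist_V) U -> section_of M (orth g dist_V) V ->
            forall p, M p -> curvature g U V Y p = 0]
    & (* (iii) *)
      forall p, M p ->
        (exists B, adapted_basis g p B) /\
        (forall B, adapted_basis g p B ->
           [set invmx B *m A *m B | A in holonomy_algebra g M p]
             `<=` hol_block_algebra)].
Proof.
have F1 := F_smooth 1.
split.
- by split; [exact: Vtilde_connection_invariant|exact: Vtilde_transport_invariant].
- split=> [p Mp|p Mp|U V Y sU sV sY oU oV p Mp].
  + by rewrite inner_evec_v !mxE adim_eqE mulr0.
  + exact: orth_dist_V.
  (* Orthogonality to d_v enters the curvature computation as the vanishing of the u-component on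
     all of [M]. *)
  + have hyp (X : 'cV[R]_(adim m) -> 'cV[R]_(adim m)) :
        section_of ambient_space (orth (ambient_metric F) dist_V) X ->
        forall q, ambient_space q -> X q i_u 0 = 0.
      by move=> oX q Mq; apply/(dist_hyperplaneP q); rewrite -(orth_dist_V F Mq); exact: oX.
    exact: (curvature_hyperplane F_smooth sU sV sY (hyp U oU) (hyp V oV) Mp).
- move=> p Mp; split; first by exists (frame F p); exact: adapted_frame.
  move=> B HB _ [A HA <-].
  exact: hol_block_conj Mp (holonomy_algebra_constraints F1 HA) HB.
Qed.
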